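(* Let $i,j,k,l\in\mathbb N$ such that $\{i,j,k,l\}=\{0,1,2,3\}$, and let $C\subset L^3_2$ be a tropical curve such that $$C\subset\mathrm{cone}([e_i],[e_j])\cup\mathrm{cone}([e_k],[e_l])$$ and $m_C(e_i)=m_C(e_j)=m_C(e_k)=0$. Then $C$ can only be realizable in $L$ if $m_C(e_l)\ne1$.
   Context: Let $K$ be an algebraically closed field (of any characteristic), $S=K[x_0^{\pm1},\dots,x_3^{\pm1}]$, $S_0$ its degree-$0$ part, $X=\mathrm{Spec}(S_0)$ the $3$-dimensional torus, $L=(x_0+x_1+x_2+x_3)\subset S$, $L_0=L\cap S_0$, and $E=\mathrm{Spec}(S_0/L_0)$. In $\mathbb R^4/\langle\mathbf 1\rangle$, $\mathbf 1=(1,1,1,1)$, with lattice $\mathbb Z^4/\langle\mathbf 1\rangle$, write $[v]$ for the class of $v$ and $e_0,\dots,e_3$ for the unit vectors. $L^3_2=\mathrm{trop}(E)$ is the $2$-dimensional fan with maximal cones $\mathrm{cone}([e_i],[e_j])$, $i<j$, all of multiplicity $1$. A tropical curve in $L^3_2$ is a $1$-dimensional rational fan with support in $L^3_2$ and non-negative integer multiplicities $m(\sigma)$ on its rays with $\sum_\sigma m(\sigma)u_\sigma=0$, where $u_\sigma$ is the primitive lattice generator of $\sigma$. $m_C(e_i)$ denotes the multiplicity in $C$ of the ray spanned by $[e_i]$ ($0$ if this is not a ray of $C$). Tropicalization (trivial valuation, min-convention): for $f=\sum_\nu a_\nu x^\nu\in S_0$ and $\omega\in\mathbb R^4$ let $\mathrm{in}_\omega(f)$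 be the sum of the terms $a_\nu x^\nu$, $a_\nu\ne0$, with $\omega\cdot\nu$ minimal; $\mathrm{in}_\omega(I)$ is the ideal generated by all $\mathrm{in}_\omega(f)$, $f\in I$. For an irreducible curve $Y\subset X$ with prime ideal $P\subset S_0$, $\mathrm{trop}(Y)\subset\mathbb R^4/\langle\mathbf 1\rangle$ is the image of $\{\omega:\mathrm{in}_\omega(P)\ne S_0\}$, with multiplicity $\sum_Q\ell((S_0/\mathrm{in}_\omega(P))_Q)$ on a ray $\sigma$, where $\omega$ is in the relative interior of $\sigma$ and $Q$ runs over the minimal primes of $\mathrm{in}_\omega(P)$. Extend this linearly to a map $\mathrm{Trop}$ on $1$-cycles. $C$ is realizable in $L$ if there is an effective $1$-cycle $Y$ in $E$ (a non-negative integer combination of irreducible curves in $E$) with $\mathrm{Trop}(Y)=C$. *)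

(* Defs.v *)
From HB Require Import structures.
From mathcomp Require Import all_boot all_order all_algebra ring.
From mathcomp Require Import finmap generic_quotient ring_quotient.
From mathcomp Require Import boolp classical_sets reals ereal esum.
(* The notations of monalg clash with those of mathcomp-analysis. *)
From mathcomp Require Import -(notations) monalg.

Set Implicit Arguments.
Unset Strict Implicit.
Unset Printing Implicit Defensive.

Import Order.TTheory GRing.Theory Num.Theory.

Local Open Scope classical_set_scope.
Local Open Scope ring_scope.

Section Ideals.
Variable A : comPzRingType.

(* The unit ideal is allowed, contrary to [idealr] of ring_quotient. *)
Definition is_ideal (I : set A) :=
  [/\ I 0, forall x y, I x -> I y -> I (x + y) & forall a x, I x -> I (a * x)].

Record ideal := Ideal { ideal_set :> set A; idealP : is_ideal ideal_set }.

Definition is_prime (P : set A) := ~ P 1 /\ forall x y, P (x * y) -> P x \/ P y.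

Record prime_ideal :=
  PrimeIdeal { prime_ideal_val :> ideal; primeP : is_prime prime_ideal_val }.

HB.instance Definition _ := gen_eqMixin prime_ideal.
HB.instance Definition _ := gen_choiceMixin prime_ideal.

Definition generated (G : set A) : set A :=
  [set x | forall I : ideal, G `<=` I -> ideal_set I x].

Fact generated_ideal G : is_ideal (generated G).
Proof.
split=> [I _|x y Gx Gy I GI|a x Gx I GI]; case: (idealP I) => I0 ID IM.
- exact: I0.
- by apply: ID; [exact: Gx|exact: Gy].
- by apply: IM; exact: Gx.
Qed.

Definition ideal_gen (G : set A) : ideal := Ideal (generated_ideal G).

Definition minimal_prime (I : ideal) (Q : prime_ideal) :=
  I `<=` Q /\ forall Q' : prime_ideal, I `<=` Q' -> Q' `<=` Q -> Q `<=` Q'.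

(* There is a strict chain of n+1 primes containing I: dim (A / I) >= n. *)
Definition prime_chain (I : ideal) (n : nat) :=
  exists Q : nat -> prime_ideal,
    (forall m, (m <= n)%N -> I `<=` Q m) /\
    (forall m, (m < n)%N -> Q m `<` Q m.+1).

Definition quotient_has_dim (I : ideal) (n : nat) :=
  prime_chain I n /\ ~ prime_chain I n.+1.

Definition ideal_chain (n : nat) :=
  exists J : nat -> ideal, forall m, (m < n)%N -> J m `<` J m.+1.

(* The length of A as a module over itself, possibly +oo. *)
Definition ring_length (R : realType) : \bar R :=
  ereal_sup [set (n%:R)%:E | n in ideal_chain].

End Ideals.

(* Fractions a / s with a in A and s outside Q; a / s = b / t when
   u (a t - b s) lies in I for some u outside Q. *)
Section Localization.
Variables (A : comPzRingType) (I : ideal A) (Q : prime_ideal A).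

Definition denominator := {s : A | `[< ~ ideal_set Q s >]}.
Implicit Types (a b : A) (s t : denominator) (x y z : A * denominator).

Fact den_subproof1 : `[< ~ ideal_set Q 1 >]. Proof. by apply/asboolP; case: (primeP Q). Qed.
Fact den_subproofM s t : `[< ~ ideal_set Q (val s * val t) >].
Proof.
case: s t => [s /= /asboolP Qs] [t /= /asboolP Qt].
by apply/asboolP => /(primeP Q).2[].
Qed.
Definition den1 : denominator := Sub 1 den_subproof1.
Definition denM s t : denominator := Sub (val s * val t) (den_subproofM s t).

Definition loc_eq x y : bool :=
  `[< exists u : denominator, ideal_set I (val u * (x.1 * val y.2 - y.1 * val x.2)) >].

Let I0 : ideal_set I 0. Proof. by case: (idealP I). Qed.
Let ID a b : ideal_set I a -> ideal_set I b -> ideal_set I (a + b). Proof. by case: (idealP I) => _ + _; exact. Qed.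
Let IM a b : ideal_set I b -> ideal_set I (a * b). Proof. by case: (idealP I) => _ _; exact. Qed.

Fact loc_eq_equiv : equiv_class_of loc_eq.
Proof.
have sym x y : loc_eq x y -> loc_eq y x.
  move=> /asboolP[u Iu]; apply/asboolP; exists u.
  have -> : val u * (y.1 * val x.2 - x.1 * val y.2) =
    -1 * (val u * (x.1 * val y.2 - y.1 * val x.2)) by ring.
  exact: IM.
split=> [x|x y|y x z].
- by apply/asboolP; exists den1; rewrite subrr mulr0.
- by apply/idP/idP; exact: sym.
- move=> /asboolP[u Iu] /asboolP[v Iv]; apply/asboolP.
  exists (denM (denM u v) y.2) => /=.
  have -> : val u * val v * val y.2 * (x.1 * val z.2 - z.1 * val x.2) =
    (val v * val z.2) * (val u * (x.1 * val y.2 - y.1 * val x.2)) +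
    (val u * val x.2) * (val v * (y.1 * val z.2 - z.1 * val y.2)) by ring.
  by apply: ID; exact: IM.
Qed.

Canonical loc_equiv := EquivRelPack loc_eq_equiv.
Canonical loc_encModRel := defaultEncModRel loc_eq.

Definition localization := {eq_quot loc_eq}%qT.
HB.instance Definition _ := Choice.on localization.

Definition frac a s : localization := \pi_localization%qT (a, s).
Definition num (p : localization) : A := (repr p).1.
Definition den (p : localization) : denominator := (repr p).2.

Lemma fracE p : frac (num p) (den p) = p.
Proof. by rewrite /frac /num /den -surjective_pairing reprK. Qed.

Lemma frac_ind (P : localization -> Prop) :
  (forall a s, P (frac a s)) -> forall p, P p.
Proof. by move=> Pf p; rewrite -[p]fracE. Qed.

Lemma fracP a s b t : frac a s = frac b t <->
  exists u : denominator, ideal_set I (val u * (a * val t - b * val s)).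
Proof.
split=> [/eqP|h]; first by rewrite eqmodE => /asboolP.
by apply/eqP; rewrite eqmodE; apply/asboolP.
Qed.

Lemma num_denP a s : exists u : denominator,
  ideal_set I (val u * (num (frac a s) * val s - a * val (den (frac a s)))).
Proof. by apply/fracP; rewrite fracE. Qed.

Definition loc_add (p q : localization) : localization :=
  frac (num p * val (den q) + num q * val (den p)) (denM (den p) (den q)).
Definition loc_mul (p q : localization) : localization :=
  frac (num p * num q) (denM (den p) (den q)).
Definition loc_opp (p : localization) : localization := frac (- num p) (den p).

Lemma loc_addE a s b t :
  loc_add (frac a s) (frac b t) = frac (a * val t + b * val s) (denM s t).
Proof.
have [[u Iu] [v Iv]] := (num_denP a s, num_denP b t).
apply/fracP; exists (denM u v) => /=.
move: (num (frac a s)) (den (frac a s)) (num (frac b t)) (den (frac b t)) Iu Iv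
  => a' s' b' t' Iu Iv.
rewrite (_ : _ * _ =
  val v * val t * val t' * (val u * (a' * val s - a * val s')) +
  val u * val s * val s' * (val v * (b' * val t - b * val t'))); last by rewrite /=; ring.
by apply: ID; exact: IM.
Qed.

Lemma loc_mulE a s b t :
  loc_mul (frac a s) (frac b t) = frac (a * b) (denM s t).
Proof.
have [[u Iu] [v Iv]] := (num_denP a s, num_denP b t).
apply/fracP; exists (denM u v) => /=.
move: (num (frac a s)) (den (frac a s)) (num (frac b t)) (den (frac b t)) Iu Iv
  => a' s' b' t' Iu Iv.
rewrite (_ : _ * _ =
  val v * b' * val t * (val u * (a' * val s - a * val s')) +
  val u * a * val s' * (val v * (b' * val t - b * val t'))); last by rewrite /=; ring.
by apply: ID; exact: IM.
Qed.

Lemma loc_oppE a s : loc_opp (frac a s) = frac (- a) s.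
Proof.
have [u Iu] := num_denP a s.
apply/fracP; exists u; move: (num _) (den _) Iu => a' s' Iu.
rewrite (_ : _ * _ = -1 * (val u * (a' * val s - a * val s'))); last by rewrite /=; ring.
exact: IM.
Qed.

Lemma eq_frac a s b t : a * val t = b * val s -> frac a s = frac b t.
Proof. by move=> e; apply/fracP; exists den1; rewrite e subrr mulr0. Qed.

Fact loc_addA : associative loc_add.
Proof.
elim/frac_ind=> a s; elim/frac_ind=> b t; elim/frac_ind=> c r.
by rewrite !loc_addE; apply: eq_frac => /=; ring.
Qed.
Fact loc_addC : commutative loc_add.
Proof.
elim/frac_ind=> a s; elim/frac_ind=> b t.
by rewrite !loc_addE; apply: eq_frac => /=; ring.
Qed.
Fact loc_add0 : left_id (frac 0 den1) loc_add.
Proof.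
by elim/frac_ind=> a s; rewrite !loc_addE; apply: eq_frac => /=; ring.
Qed.
Fact loc_addN : left_inverse (frac 0 den1) loc_opp loc_add.
Proof.
by elim/frac_ind=> a s; rewrite !loc_oppE !loc_addE; apply: eq_frac => /=; ring.
Qed.
HB.instance Definition _ :=
  GRing.isZmodule.Build localization loc_addA loc_addC loc_add0 loc_addN.

Fact loc_mulA : associative loc_mul.
Proof.
elim/frac_ind=> a s; elim/frac_ind=> b t; elim/frac_ind=> c r.
by rewrite !loc_mulE; apply: eq_frac => /=; ring.
Qed.
Fact loc_mulC : commutative loc_mul.
Proof.
elim/frac_ind=> a s; elim/frac_ind=> b t.
by rewrite !loc_mulE; apply: eq_frac => /=; ring.
Qed.
Fact loc_mul1 : left_id (frac 1 den1) loc_mul.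
Proof.
by elim/frac_ind=> a s; rewrite !loc_mulE; apply: eq_frac => /=; ring.
Qed.
Fact loc_mulD : left_distributive loc_mul loc_add.
Proof.
elim/frac_ind=> a s; elim/frac_ind=> b t; elim/frac_ind=> c r.
by rewrite !(loc_mulE, loc_addE); apply: eq_frac => /=; ring.
Qed.
HB.instance Definition _ := GRing.Zmodule_isComPzRing.Build localization
  loc_mulA loc_mulC loc_mul1 loc_mulD.

End Localization.

Section Laurent.
Variable K : comNzRingType.

Local Notation expo := 'rV[int]_4.

(* S = K[x_0^{+-1}, ..., x_3^{+-1}], the group algebra of Z^4.  Its product is
   defined here since monalg only treats monoids without nontrivial units. *)
Definition laurent := monalg.malg expo K.
HB.instance Definition _ := GRing.Lmodule.on laurent.

Definition coef (nu : expo) (f : laurent) : K := monalg.mcoeff nu f.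
Definition lsupp (f : laurent) : {fset expo} := monalg.msupp f.
Definition monom (c : K) (nu : expo) : laurent := monalg.mkmalgU nu c.

Implicit Types (f g h : laurent) (mu nu : expo).

Definition laurent_mul f g : laurent :=
  \sum_(mu <- lsupp f) \sum_(nu <- lsupp g)
     monom (coef mu f * coef nu g) (mu + nu).

Lemma laurent_mulw (d1 d2 : {fset expo}) f g :
  (lsupp f `<=` d1)%fset -> (lsupp g `<=` d2)%fset ->
  laurent_mul f g = \sum_(mu <- d1) \sum_(nu <- d2)
     monom (coef mu f * coef nu g) (mu + nu).
Proof.
move=> le1 le2; rewrite /laurent_mul (big_fset_incl _ le1) /=.
  apply/eq_bigr=> mu _; apply/big_fset_incl => // nu _ /monalg.mcoeff_outdom.
  by rewrite /coef /monom => ->; rewrite mulr0 monalg.monalgU0.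
move=> mu _ /monalg.mcoeff_outdom fmu.
by rewrite big1 // => nu _; rewrite /monom /coef fmu mul0r monalg.monalgU0.
Qed.

Fact laurent_mulC : commutative laurent_mul.
Proof.
move=> f g; rewrite /laurent_mul exchange_big /=.
by apply: eq_bigr => nu _; apply: eq_bigr => mu _; rewrite mulrC addrC.
Qed.

Fact laurent_mulDl : left_distributive laurent_mul +%R.
Proof.
move=> f g h.
have le : (lsupp (f + g)%R `<=` lsupp f `|` lsupp g)%fset.
  exact: monalg.msuppD_le.
rewrite (laurent_mulw le (fsubset_refl _)).
rewrite (laurent_mulw (fsubsetUl (lsupp f) (lsupp g)) (fsubset_refl _)).
rewrite (laurent_mulw (fsubsetUr (lsupp f) (lsupp g)) (fsubset_refl _)).
rewrite -big_split /=; apply/eq_bigr=> mu _.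
rewrite -big_split /=; apply/eq_bigr=> nu _.
by rewrite /coef monalg.mcoeffD mulrDl /monom monalg.monalgUD.
Qed.

Fact laurent_mulDr : right_distributive laurent_mul +%R.
Proof.
by move=> f g h; rewrite !(laurent_mulC f) laurent_mulDl.
Qed.

Fact laurent_mul0l : left_zero 0 laurent_mul.
Proof. by move=> g; rewrite /laurent_mul /lsupp monalg.msupp0 big_seq_fset0. Qed.

Fact laurent_mul0r : right_zero 0 laurent_mul.
Proof. by move=> g; rewrite laurent_mulC laurent_mul0l. Qed.

Lemma monomM a b mu nu :
  laurent_mul (monom a mu) (monom b nu) = monom (a * b) (mu + nu).
Proof.
rewrite (laurent_mulw monalg.msuppU_le monalg.msuppU_le) !big_seq_fset1.
by rewrite /coef /monom !monalg.mcoeffUU.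
Qed.

Lemma laurentE f : f = \sum_(nu <- lsupp f) monom (coef nu f) nu.
Proof. exact: monalg.monalgE. Qed.

Lemma laurent_ind (P : laurent -> Prop) :
  P 0 -> (forall f g, P f -> P g -> P (f + g)) ->
  (forall c nu, P (monom c nu)) -> forall f, P f.
Proof. by move=> P0 PD PU f; rewrite (laurentE f); apply: big_ind. Qed.

Fact laurent_mulA : associative laurent_mul.
Proof.
move=> f g h; elim/laurent_ind: f => [|f1 f2 e1 e2|a mu].
- by rewrite !laurent_mul0l.
- by rewrite !laurent_mulDl e1 e2.
elim/laurent_ind: g => [|f1 f2 e1 e2|b nu].
- by rewrite !(laurent_mul0l, laurent_mul0r).
- by rewrite !(laurent_mulDl, laurent_mulDr) e1 e2.
elim/laurent_ind: h => [|f1 f2 e1 e2|c la].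
- by rewrite !(laurent_mul0l, laurent_mul0r).
- by rewrite !(laurent_mulDl, laurent_mulDr) e1 e2.
by rewrite !monomM mulrA addrA.
Qed.

Fact laurent_mul1 : left_id (monom 1 0) laurent_mul.
Proof.
move=> f; elim/laurent_ind: f => [|f1 f2 e1 e2|b nu].
- by rewrite laurent_mul0r.
- by rewrite laurent_mulDr e1 e2.
by rewrite monomM mul1r add0r.
Qed.

Fact laurent_one_neq0 : monom 1 0 != 0.
Proof.
apply/eqP => /monalg.malgP /(_ 0) /eqP.
by rewrite /monom monalg.mcoeffUU monalg.mcoeff0 oner_eq0.
Qed.

HB.instance Definition _ := GRing.Zmodule_isComNzRing.Build laurent
  laurent_mulA laurent_mulC laurent_mul1 laurent_mulDl laurent_one_neq0.

Definition lvar (i : 'I_4) : laurent := monom 1 (delta_mx 0 i).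

Definition expo_deg (nu : expo) : int := \sum_i nu 0 i.

Definition deg0 : {pred laurent} :=
  fun f => all (fun nu => expo_deg nu == 0) (lsupp f).

Lemma deg0P f :
  reflect (forall nu, coef nu f != 0 -> expo_deg nu = 0) (f \in deg0).
Proof.
apply: (iffP allP) => h nu; last by rewrite -monalg.mcoeff_neq0 => /h ->.
by rewrite /coef monalg.mcoeff_neq0 => /h /eqP.
Qed.

Lemma deg0_monom c nu : expo_deg nu = 0 -> monom c nu \in deg0.
Proof.
move=> e; apply/deg0P => mu; rewrite /coef /monom monalg.mcoeffU.
by case: (eqVneq nu mu) => [<-//|_]; rewrite mulr0n eqxx.
Qed.

Fact deg0_subring : GRing.subring_closed deg0.
Proof.
have d0 : 0 \in deg0 by apply/deg0P => nu; rewrite /coef monalg.mcoeff0 eqxx.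
have dD : {in deg0 &, forall f g, f + g \in deg0}.
  move=> f g /deg0P df /deg0P dg; apply/deg0P => nu.
  rewrite /coef monalg.mcoeffD; have [f0|/df //] := eqVneq (coef nu f) 0.
  by rewrite -[monalg.mcoeff nu f]/(coef nu f) f0 add0r => /dg.
have degD mu nu : expo_deg (mu + nu) = expo_deg mu + expo_deg nu.
  by rewrite /expo_deg -big_split; apply: eq_bigr => i _; rewrite mxE.
split=> [|f g df /deg0P dg|f g /allP df /allP dg].
- by apply: deg0_monom; rewrite /expo_deg big1 // => i _; rewrite mxE.
- apply: dD => //; apply/deg0P => nu.
  by rewrite /coef monalg.mcoeffN oppr_eq0; exact: dg.
- rewrite -[f * g]/(laurent_mul f g) /laurent_mul big_seq.
  apply: (big_ind (fun h => h \in deg0)) => // mu /df /eqP emu; rewrite big_seq.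
  apply: (big_ind (fun h => h \in deg0)) => // nu /dg /eqP enu.
  by apply: deg0_monom; rewrite degD emu enu addr0.
Qed.

HB.instance Definition _ := GRing.isSubringClosed.Build laurent deg0 deg0_subring.

Record laurent0 := Laurent0 { laurent0_val :> laurent; _ : laurent0_val \in deg0 }.
HB.instance Definition _ := [isSub for laurent0_val].
HB.instance Definition _ := [Choice of laurent0 by <:].
HB.instance Definition _ := [SubChoice_isSubComNzRing of laurent0 by <:].

Definition L_ideal : ideal laurent := ideal_gen [set \sum_i lvar i].

Fact L0_is_ideal : is_ideal [set f : laurent0 | ideal_set L_ideal (val f)].
Proof.
case: (idealP L_ideal) => L0 LD LM; split=> [|f g Lf Lg|f g Lg].
- by rewrite /mkset raddf0.
- by rewrite /mkset raddfD; exact: LD.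
- by rewrite /mkset rmorphM; exact: LM.
Qed.

Definition L0_ideal : ideal laurent0 := Ideal L0_is_ideal.

Section Initial.
Variable R : realType.
Implicit Type w : 'rV[R]_4.

Definition weight w (nu : expo) : R := \sum_i w 0 i * (nu 0 i)%:~R.

Definition initial_terms w (f : laurent) : laurent :=
  \sum_(nu <- lsupp f | all (fun mu => weight w nu <= weight w mu) (lsupp f))
     monom (coef nu f) nu.

Fact initial_terms_deg0 w (f : laurent0) : initial_terms w (val f) \in deg0.
Proof.
case: f => f /= /allP df; rewrite /initial_terms big_seq_cond.
by apply: rpred_sum => nu /andP[/df /eqP dnu _]; exact: deg0_monom.
Qed.

Definition initial_form w (f : laurent0) : laurent0 :=
  Laurent0 (initial_terms_deg0 w f).

Definition initial_ideal w (I : ideal laurent0) : ideal laurent0 :=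
  ideal_gen [set initial_form w f | f in I].

End Initial.
End Laurent.

Section Quotient.
Variable A : pzRingType.

Definition ones : {pred 'rV[A]_4} := fun v => v == const_mx (v 0 0).

Fact ones_zmod_closed : zmod_closed ones.
Proof.
split=> [|u v /eqP eu /eqP ev].
  by apply/eqP/matrixP => i j; rewrite !mxE.
apply/eqP/matrixP => i j; rewrite [in LHS]eu [in LHS]ev !mxE //.
Qed.
HB.instance Definition _ :=
  GRing.isZmodClosed.Build 'rV[A]_4 ones ones_zmod_closed.

Definition mod1 := Quotient.quot ones.
HB.instance Definition _ := GRing.Zmodule.on mod1.

Definition cls (v : 'rV[A]_4) : mod1 := (\pi_(Quotient.quot ones) v)%qT.

Definition cls_e (i : 'I_4) : mod1 := cls (delta_mx 0 i).

Lemma clsP u v : cls u = cls v <-> exists c, u - v = const_mx c.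
Proof.
rewrite /cls; split=> [/eqP|[c e]].
  by rewrite -Quotient.idealrBE => /eqP ->; eexists.
by apply/eqP; rewrite -Quotient.idealrBE e; apply/eqP/matrixP => i j; rewrite !mxE.
Qed.

Lemma cls_repr (x : mod1) : cls (repr x) = x. Proof. exact: reprK. Qed.

Lemma clsD u v : cls (u + v) = cls u + cls v.
Proof. exact: (raddfD (\pi_(Quotient.quot ones))%qT). Qed.

Definition mod1_scale (a : A) (x : mod1) : mod1 := cls (a *: repr x).

Lemma mod1_scaleE a v : mod1_scale a (cls v) = cls (a *: v).
Proof.
have /clsP[c e] := cls_repr (cls v).
apply/clsP; exists (a * c); rewrite -scalerBr e.
by apply/matrixP => i j; rewrite !mxE.
Qed.

Fact mod1_scaleA a b x : mod1_scale a (mod1_scale b x) = mod1_scale (a * b) x.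
Proof. by rewrite -[x]cls_repr !mod1_scaleE scalerA. Qed.
Fact mod1_scale1 : left_id 1 mod1_scale.
Proof. by move=> x; rewrite -[x]cls_repr mod1_scaleE scale1r. Qed.
Fact mod1_scaleDr : right_distributive mod1_scale +%R.
Proof.
move=> a x y; rewrite -[x]cls_repr -[y]cls_repr -clsD !mod1_scaleE.
by rewrite scalerDr clsD.
Qed.
Fact mod1_scaleDl x : {morph mod1_scale^~ x : a b / a + b}.
Proof.
by move=> a b; rewrite -[x]cls_repr !mod1_scaleE scalerDl clsD.
Qed.
HB.instance Definition _ := GRing.Zmodule_isLmodule.Build A mod1
  mod1_scaleA mod1_scale1 mod1_scaleDr mod1_scaleDl.

End Quotient.

Section Tropical.
Variable R : realType.

(* Initial forms of elements of S_0 do not depend on the representative. *)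
Definition lift_real (u : mod1 int) : 'rV[R]_4 := map_mx intr (repr u).

(* The primitive generators u of the rational rays (0 is excluded). *)
Definition primitive (u : mod1 int) :=
  forall (v : mod1 int) (n : nat), u = v *+ n -> n = 1%N.

Definition ray (u : mod1 int) : set (mod1 R) :=
  [set a *: cls (lift_real u) | a in [set a : R | 0 <= a]].

Definition cone2 (x y : mod1 R) : set (mod1 R) :=
  [set z | exists a b : R, [/\ 0 <= a, 0 <= b & z = a *: x + b *: y]].

Definition L32 : set (mod1 R) :=
  [set z | exists i j : 'I_4, (i < j)%N /\ cone2 (cls_e R i) (cls_e R j) z].

(* A fan is given by the multiplicities of its rays, each ray being represented
   by its primitive generator; rays of multiplicity 0 are discarded. *)
Record tropical_curve := TropicalCurve {
  mult : {fsfun mod1 int -> nat with 0%N};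
  _ : forall u, u \in finsupp mult -> primitive u;
  _ : \sum_(u <- finsupp mult) u *+ mult u = 0;
  _ : forall u, u \in finsupp mult -> ray u `<=` L32
}.

Definition curve_supp (C : tropical_curve) : set (mod1 R) :=
  [set z | exists2 u, u \in finsupp (mult C) & ray u z].

Variable K : closedFieldType.
Implicit Types P : prime_ideal (laurent0 K).

Definition trop P : set (mod1 R) :=
  [set cls w | w in [set w : 'rV[R]_4 | ~ initial_ideal w P = setT :> set _]].

(* The multiplicity, at w in its relative interior, of a ray of trop P. *)
Definition trop_mult P (w : 'rV[R]_4) : \bar R :=
  (\esum_(Q in [set Q | minimal_prime (initial_ideal w P) Q])
     ring_length (localization (initial_ideal w P) Q) R)%R.

(* A curve is given by its prime ideal; E is the closed set of primes above L_0. *)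
Definition curve_in_E P := L0_ideal K `<=` P /\ quotient_has_dim P 1.

Record effective_cycle_E := EffectiveCycleE {
  cycle_coef : {fsfun prime_ideal (laurent0 K) -> nat with 0%N};
  _ : forall P, P \in finsupp cycle_coef -> curve_in_E P
}.

Implicit Type Y : effective_cycle_E.

Definition Trop_supp Y : set (mod1 R) :=
  [set z | exists2 P, P \in finsupp (cycle_coef Y) & trop P z].

Definition Trop_mult Y (u : mod1 int) : \bar R :=
  (\sum_(P <- finsupp (cycle_coef Y))
     (cycle_coef Y P)%:R%:E * trop_mult P (lift_real u))%E.

Definition Trop_eq Y (C : tropical_curve) :=
  Trop_supp Y = curve_supp C /\
  forall u, primitive u -> Trop_mult Y u = (mult C u)%:R%:E.

Definition realizable_in_L (C : tropical_curve) :=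
  exists Y : effective_cycle_E, Trop_eq Y C.

End Tropical.

(* Main.v *)
(* Let P be the prime of a component of the cycle, with coordinates x_0, ..., x_3
   of its generic point.  If x_i + x_j = 0 then the initial ideal of P at e_l is the
   unit ideal.  Otherwise normalize x_i + x_j = -1 and x_k + x_l = 1; in the
   coordinates U = x_l and V = x_i the curve is the zero set of a polynomial f, and
   the four coordinate lines are the sides U = 0, U = 1, V = 0, V = -1 of a square.
   If f vanished at a point of a side other than U = 0, then some initial ideal of P
   would be proper for a weight excluded by the hypotheses: e_i, e_j or e_k if the
   point is not a corner, and at a corner the weight of an edge of the Newton polygon
   of f there.  So f has no zero, hence is constant, on each of these three sides,
   and phi(V) = f(0, V) satisfies phi(0) = phi(-1), this value being nonzero.  The
   multiplicity at e_l counts the roots of phi, so it would be 1 only for phi of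
   degree 1, but then phi(0) <> phi(-1).  Hence every component has multiplicity 0 or
   at least 2 at e_l. *)

From HB Require Import structures.
Require Import Defs.
From mathcomp Require Import all_boot all_order all_algebra ring zify.
From mathcomp Require Import finmap boolp classical_sets reals ereal.
From mathcomp Require Import cardinality fsbigop esum.

Set Implicit Arguments.
Unset Strict Implicit.
Unset Printing Implicit Defensive.

Import Order.TTheory GRing.Theory Num.Theory.

Local Open Scope classical_set_scope.
Local Open Scope ring_scope.

(** * Polynomials in two variables *)

(** An initial ideal is generated by the initial forms of all elements of P, and no finite set of
    generators is at hand. Two kinds of evidence replace it. On the one hand, a suitable zero of f
    yields, through the substitution (U, V) -> (U t^al, V t^be), a point of the torus at which all
    initial forms vanish; its coordinates lie in K, in K(z), or in the dual numbers over K(z). On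
    the other hand, at e_l the elements phi(x_i / x_k) and (x_k + x_i + x_j) / x_k of the initial
    ideal determine which primes can be minimal over it. So the multiplicity at e_l is bounded below
    without being computed: two distinct roots of phi give two minimal primes, and a double root
    gives a local ring of length at least 2, as the dual numbers detect its tangent direction. The
    equation f exists because the kernel of evaluation at the generic point is principal unless U
    and V are both constants; that they are not comes from P having dimension one. *)

Section Bieval.
Variables (A R : comNzRingType) (iota : {rmorphism A -> R}) (u v : R).

Definition ueval : {poly A} -> R :=
  horner_morph (fun c => mulrC u (iota c) : GRing.comm u (iota c)).
HB.instance Definition _ := GRing.RMorphism.on ueval.

(* The inner variable of [{poly {poly A}}] goes to [u], the outer one to [v]. *)
Definition bieval : {poly {poly A}} -> R :=
  horner_morph (fun c => mulrC v (ueval c) : GRing.comm v (ueval c)).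
HB.instance Definition _ := GRing.RMorphism.on bieval.

Lemma uevalC c : ueval c%:P = iota c.
Proof. exact: horner_morphC. Qed.
Lemma uevalX : ueval 'X = u.
Proof. exact: horner_morphX. Qed.
Lemma ueval_sum p : ueval p = \sum_(i < size p) iota p`_i * u ^+ i.
Proof.
rewrite -{1}[p]coefK poly_def rmorph_sum; apply: eq_bigr => i _.
by rewrite -mul_polyC rmorphM rmorphXn /= uevalC uevalX.
Qed.

Lemma bievalC p : bieval p%:P = ueval p.
Proof. exact: horner_morphC. Qed.
Lemma bievalCC c : bieval c%:P%:P = iota c.
Proof. by rewrite bievalC uevalC. Qed.
Lemma bievalY : bieval 'X%:P = u.
Proof. by rewrite bievalC uevalX. Qed.
Lemma bievalX : bieval 'X = v.
Proof. exact: horner_morphX. Qed.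

Lemma bieval_subX b : bieval ('X - b%:P%:P) = v - iota b.
Proof. by rewrite raddfB /= bievalX bievalCC. Qed.
Lemma bieval_subY a : bieval ('X - a%:P)%:P = u - iota a.
Proof. by rewrite bievalC raddfB /= uevalX uevalC. Qed.

Lemma bieval_NX : bieval (- 'X) = - v.
Proof. by rewrite raddfN /= bievalX. Qed.
Lemma bieval_NY : bieval (- 'X%:P) = - u.
Proof. by rewrite raddfN /= bievalY. Qed.
Lemma bieval_1DX : bieval (1 + 'X) = 1 + v.
Proof. by rewrite raddfD /= rmorph1 bievalX. Qed.
Lemma bieval_1BY : bieval (1 - 'X%:P) = 1 - u.
Proof. by rewrite raddfB /= rmorph1 bievalY. Qed.
Lemma bieval_N1BX : bieval (- 1 - 'X) = - 1 - v.
Proof. by rewrite raddfB raddfN /= rmorph1 bievalX. Qed.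

Lemma bieval_outer f : bieval f = \sum_(j < size f) ueval f`_j * v ^+ j.
Proof.
rewrite -{1}[f]coefK poly_def rmorph_sum; apply: eq_bigr => i _.
by rewrite -mul_polyC rmorphM rmorphXn /= bievalC bievalX.
Qed.

Lemma bieval_sum f :
  bieval f = \sum_(j < size f) \sum_(i < size f`_j) iota f`_j`_i * u ^+ i * v ^+ j.
Proof.
rewrite bieval_outer; apply: eq_bigr => j _.
by rewrite ueval_sum mulr_suml.
Qed.

Lemma bieval_uniq (h : {rmorphism {poly {poly A}} -> R}) :
  (forall c, h c%:P%:P = iota c) -> h 'X%:P = u -> h 'X = v -> h =1 bieval.
Proof.
move=> hC hY hX f.
rewrite -{1}[f]coefK poly_def rmorph_sum bieval_sum; apply: eq_bigr => j _.
rewrite -mul_polyC rmorphM rmorphXn /= hX -{1}[f`_j]coefK poly_def.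
rewrite !rmorph_sum mulr_suml; apply: eq_bigr => i _.
by rewrite -mul_polyC /= !(rmorphM, rmorphXn) /= hC hY.
Qed.

End Bieval.

Lemma bieval_comp (A R R' : comNzRingType) (iota : {rmorphism A -> R})
  (iota' : {rmorphism A -> R'}) (h : {rmorphism R -> R'}) u v f :
  (forall c, h (iota c) = iota' c) ->
  h (bieval iota u v f) = bieval iota' (h u) (h v) f.
Proof.
move=> hi; apply: (bieval_uniq (h := h \o bieval iota u v)) => [c||] /=.
- by rewrite bievalCC hi.
- by rewrite bievalY.
- by rewrite bievalX.
Qed.

Section Divide.
Variable K : fieldType.
Implicit Types (f G h : {poly {poly K}}).

(** [bieval polyC a%:P 'X f] is the restriction of f to the line U = a, a polynomial in V; likewise
    [bieval polyC 'X b%:P f] is the restriction to V = b, a polynomial in U. *)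
Lemma bieval_map_horner (a : K) f :
  bieval polyC a%:P 'X f = map_poly (horner_eval a) f.
Proof.
symmetry; apply: (bieval_uniq (h := map_poly (horner_eval a))) => [c||] /=.
- by rewrite map_polyC /= /horner_eval hornerC.
- by rewrite map_polyC /= /horner_eval hornerX.
- by rewrite map_polyX.
Qed.

Lemma bieval_horner (b : K) f : bieval polyC 'X b%:P f = f.[b%:P].
Proof.
symmetry; apply: (bieval_uniq (h := horner_eval b%:P)) => [c||] /=;
by rewrite /horner_eval !(hornerC, hornerX).
Qed.

Lemma bieval_eq0_dvdY (a : K) f :
  bieval polyC a%:P 'X f = 0 -> exists h, f = ('X - a%:P)%:P * h.
Proof.
rewrite bieval_map_horner => f0.
exists (\poly_(i < size f) (f`_i %/ ('X - a%:P))).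
apply/polyP => i; rewrite coefCM coef_poly; case: ifP => [_|]; last first.
  by move/negbT; rewrite -leqNgt => /(nth_default 0) ->; rewrite mulr0.
rewrite mulrC divpK // dvdp_XsubCl.
by have /polyP/(_ i) := f0; rewrite coef_map coef0 => /eqP.
Qed.

Lemma bieval_eq0_dvdX (b : K) f :
  bieval polyC 'X b%:P f = 0 -> exists h, f = h * ('X - b%:P%:P).
Proof. by rewrite bieval_horner => /eqP/factor_theorem. Qed.

End Divide.

Section Principal.
Variables (K : closedFieldType) (F : fieldType) (iota : {rmorphism K -> F}).

(** Over K the polynomial p splits into linear factors, and one of them must vanish at z. *)
Lemma root_closed (p : {poly K}) (z : F) :
  p != 0 -> ueval iota z p = 0 -> exists a, z = iota a.
Proof.
move=> p0; have [r ->] := closed_field_poly_normal p.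
rewrite -mul_polyC rmorphM /= uevalC => /eqP; rewrite mulf_eq0 fmorph_eq0.
rewrite lead_coef_eq0 (negPf p0) /= rmorph_prod prodf_seq_eq0.
case/hasP => a _ /=; rewrite rmorphB /= uevalX uevalC subr_eq0 => /eqP ->.
by exists a.
Qed.

(** A form of Gauss's lemma: as K is algebraically closed, f is primitive over K[U] once it vanishes
    on no line U = a. A root a of c then forces q to vanish on that line, so U - a cancels from c
    and q. *)
Lemma primitive_cancel (f : {poly {poly K}}) (c : {poly K}) (q G : {poly {poly K}}) :
  (forall a, bieval polyC a%:P 'X f != 0) -> c != 0 ->
  c%:P * G = q * f -> exists h, G = h * f.
Proof.
move=> prim; have [n] := ubnP (size c); elim: n c q => // n IHn c q szc c0 e.
have [sz1|sz1] := eqVneq (size c) 1.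
  have /size_poly1P[d d0 cd] : size c == 1 by rewrite sz1.
  exists (d^-1%:P%:P * q); rewrite -mulrA -e cd mulrA -!polyCM mulVf //.
  by rewrite mul1r.
have [a /rootP/eqP ra] := closed_rootP c sz1.
have [c' cE] := factor_theorem c a ra.
have : bieval polyC a%:P 'X q * bieval polyC a%:P 'X f = 0.
  rewrite -rmorphM -e rmorphM /= bievalC cE rmorphM rmorphB /= uevalX uevalC.
  by rewrite subrr mulr0 mul0r.
move/eqP; rewrite mulf_eq0 (negPf (prim a)) orbF => /eqP/bieval_eq0_dvdY[q' qE].
have c'0 : c' != 0 by apply: contra_neq c0 => c'0; rewrite cE c'0 mul0r.
apply: (IHn c' q') => //.
  by move: szc; rewrite cE size_Mmonic ?monicXsubC // size_XsubC addn2.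
have X0 : ('X - a%:P)%:P != 0 :> {poly {poly K}}.
  by rewrite polyC_eq0 polyXsubC_eq0.
apply: (mulfI X0); rewrite !mulrA -qE -e cE polyCM; congr (_ * _).
by rewrite mulrC.
Qed.

(** If u is a constant a and v is not constant, then U - a generates, because a nonzero G(a, V)
    would make v algebraic over K. If u is transcendental, a nonzero kernel element of least degree
    in V pseudo-divides all others, and Gauss's lemma removes the powers of its leading coefficient.
    The generator is 0 when u and v are algebraically independent. *)
Lemma bieval_ker_principal (u v : F) :
  (exists f, bieval iota u v f = 0 /\
     forall G, bieval iota u v G = 0 -> exists h, G = h * f) \/
  (exists a b, u = iota a /\ v = iota b).
Proof.
case: (pselect (exists a, u = iota a)) => [[a ua]|ntr].
  case: (pselect (exists b, v = iota b)) => [[b vb]|ntr].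
    by right; exists a, b.
  left; exists ('X - a%:P)%:P; split.
    by rewrite bievalC rmorphB /= uevalX uevalC ua subrr.
  move=> G G0.
  have [|h ->] := @bieval_eq0_dvdY K a G; last by exists h; rewrite mulrC.
  apply: contrapT => /eqP p0; apply: ntr; apply: (root_closed p0).
  rewrite -[LHS]/((ueval iota v \o bieval polyC a%:P 'X) G) -{}G0 /=.
  rewrite (@bieval_comp _ _ _ _ iota) => [|c]; last by rewrite /= uevalC.
  by rewrite /= uevalC uevalX ua.
have inj p : ueval iota u p = 0 -> p = 0.
  move=> p0; apply: contrapT => /eqP pn0.
  by apply: ntr; apply: root_closed p0.
left.
case: (pselect (exists2 f, f != 0 & bieval iota u v f = 0)); last first.
  move=> nex; exists 0; split=> [|G G0]; first by rewrite rmorph0.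
  exists 0; rewrite mul0r; apply: contrapT => /eqP Gn0.
  by apply: nex; exists G.
(* The second minimum, on the degree in U of the leading coefficient, makes f primitive: dividing
   out a factor U - a would lower it. *)
pose P n m := exists f, [/\ f != 0, bieval iota u v f = 0,
  size f = n & size (lead_coef f) = m].
move=> [f1 f1n f10].
have exn : exists n, `[<exists m, P n m >].
  by exists (size f1); apply/asboolP; exists (size (lead_coef f1)), f1.
case: (ex_minnP exn) => n /asboolP Pn minn.
have exm : exists m, `[<P n m >].
  by case: Pn => m Pm; exists m; apply/asboolP.
case: (ex_minnP exm) => m /asboolP[f [fn0 f0 szf szl]] minm.
have small G : bieval iota u v G = 0 -> (size G < size f)%N -> G = 0.
  move=> G0 ltG; apply: contrapT => /eqP Gn0.
  suff: (n <= size G)%N by rewrite -szf leqNgt ltG.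
  by apply: minn; apply/asboolP; exists (size (lead_coef G)), G.
have prim a : bieval polyC a%:P 'X f != 0.
  apply/eqP => /bieval_eq0_dvdY[h fE].
  have hn0 : h != 0 by apply: contra_neq fn0 => h0; rewrite fE h0 mulr0.
  have Xn0 : 'X - a%:P != 0 :> {poly K} by rewrite polyXsubC_eq0.
  have h0 : bieval iota u v h = 0.
    move/eqP: f0; rewrite fE rmorphM mulf_eq0 => /orP[|/eqP //].
    by rewrite /= bievalC => /eqP/inj/eqP; rewrite (negPf Xn0).
  have szh : size h = n by rewrite -szf fE mul_polyC size_scale.
  have : `[<P n (size (lead_coef h)) >] by apply/asboolP; exists h.
  move/minm; rewrite -szl fE lead_coefM lead_coefC.
  by rewrite size_monicM ?monicXsubC ?lead_coef_eq0 // size_XsubC addSn ltnn.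
exists f; split=> // G G0.
have := Pdiv.Idomain.divp_eq G f.
set k := scalp G f => e.
have r0 : G %% f = 0.
  apply: small; last by rewrite ltn_modp.
  have -> : G %% f = (lead_coef f ^+ k) *: G - G %/ f * f.
    by rewrite e addrC addKr.
  by rewrite raddfB /= -mul_polyC [X in X - _]rmorphM [X in _ - X]rmorphM /= G0 f0 !mulr0 subrr.
rewrite r0 addr0 -mul_polyC in e.
by apply: (primitive_cancel prim _ e); rewrite expf_neq0 // lead_coef_eq0.
Qed.

End Principal.

(** Lowest coefficients are multiplicative over a domain. G may itself be divisible by the variable;
    then [G.[0]] is 0 and so is a possible e. *)
Lemma lowest_coef_dvd (D : idomainType) (f G h : {poly D}) m0 m1 :
  'X^m1 * G = 'X^m0 * f * h -> f.[0] != 0 \/ f = 0 ->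
  exists e, G.[0] = f.[0] * e.
Proof.
have trivial m (p : {poly D}) : 'X^m * p = 0 -> p = 0.
  by move/eqP; rewrite mulf_eq0 expf_eq0 polyX_eq0 andbF /= => /eqP.
move=> e [f0|f0]; last first.
  exists 0; rewrite f0 mulr0 in e *.
  by rewrite mul0r in e; rewrite (trivial _ _ e) horner0 mul0r.
have [h0|h0] := eqVneq h 0.
  by exists 0; rewrite h0 mulr0 in e; rewrite (trivial _ _ e) horner0 mulr0.
have [k [h' /implyP h'0 hE]] := multiplicity_XsubC h 0.
move: h'0 => /(_ h0); rewrite /root => h'0.
have {}e : 'X^m1 * G = 'X^(m0 + k) * (f * h').
  by rewrite e hE subr0 exprD; ring.
have [le|lt] := leqP m1 (m0 + k).
  have {}e : G = 'X^(m0 + k - m1) * (f * h').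
    have X0 : 'X^m1 != 0 :> {poly D} by rewrite expf_eq0 polyX_eq0 andbF.
    by apply: (mulfI X0); rewrite e [RHS]mulrA -exprD subnKC.
  by exists (('X^(m0 + k - m1)).[0] * h'.[0]); rewrite e !hornerM; ring.
have {}e : 'X^(m1 - (m0 + k)) * G = f * h'.
  have X0 : 'X^(m0 + k) != 0 :> {poly D} by rewrite expf_eq0 polyX_eq0 andbF.
  by apply: (mulfI X0); rewrite -e [LHS]mulrA -exprD subnKC // ltnW.
move/(congr1 (fun p => p.[0])): e.
rewrite !hornerM hornerXn expr0n subn_eq0 leqNgt lt mul0r => /esym/eqP.
by rewrite mulf_eq0 (negPf f0) (negPf h'0).
Qed.

Lemma monomial_regroup (A : comNzRingType) (c u v t : A) al be p q :
  c * (u * t ^+ al) ^+ p * (v * t ^+ be) ^+ q =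
  (c * u ^+ p * v ^+ q) * t ^+ (al * p + be * q).
Proof. by rewrite !exprMn -!exprM exprD; ring. Qed.

(** * Faces and edges of the Newton polygon *)

Section Newton.
Variable K : closedFieldType.
Implicit Types (f : {poly {poly K}}).

(** If 0 were the only root, p would be a constant times a power of the variable and have a single
    nonzero coefficient. *)
Lemma nonmonomial_root (p : {poly K}) i j :
  (i < j)%N -> p`_i != 0 -> p`_j != 0 -> exists2 z, z != 0 & root p z.
Proof.
move=> ij pi pj; apply: contrapT => nroot.
have [r pE] := closed_field_poly_normal p.
have r0 : r = nseq (size r) 0.
  apply/all_pred1P/allP => z zr /=; apply: contraT => z0.
  case: nroot; exists z => //; rewrite pE /root hornerZ mulf_eq0.
  by apply/orP; right; have := root_prod_XsubC r z; rewrite zr.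
move: pE; rewrite r0 big_nseq subr0 -Monoid.iteropE -[iterop _ _ _ _]/('X ^+ _) => pE.
move: pi pj; rewrite pE !coefZ !coefXn.
have [<- _|] := eqVneq i (size r); last by rewrite mulr0 eqxx.
by rewrite gtn_eqF // mulr0 eqxx.
Qed.

(** The part of weighted degree m, where U has weight al and V has weight be. For the least m that
    occurs it is carried by a face of the Newton polygon. *)
Definition face (al be m : nat) f : {poly {poly K}} :=
  \poly_(q < size f) \poly_(p < size f`_q)
    if (al * p + be * q == m)%N then f`_q`_p else 0.

(** The embeddings of the constants are named so as to carry the morphism structure that [bieval]
    and [pev] take as an argument. *)
Definition polyCC (c : K) : {poly {poly K}} := c%:P%:P.
Fact polyCC_zmod : zmod_morphism polyCC.
Proof. by move=> a b; rewrite /polyCC !polyCB. Qed.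
Fact polyCC_monoid : monoid_morphism polyCC.
Proof. by split=> [|a b]; rewrite /polyCC ?polyC1 // !polyCM. Qed.
HB.instance Definition _ :=
  GRing.isZmodMorphism.Build K {poly {poly K}} polyCC polyCC_zmod.
HB.instance Definition _ :=
  GRing.isMonoidMorphism.Build K {poly {poly K}} polyCC polyCC_monoid.

Definition polyCCC (c : K) : {poly {poly {poly K}}} := c%:P%:P%:P.
Fact polyCCC_zmod : zmod_morphism polyCCC.
Proof. by move=> a b; rewrite /polyCCC !polyCB. Qed.
Fact polyCCC_monoid : monoid_morphism polyCCC.
Proof. by split=> [|a b]; rewrite /polyCCC ?polyC1 // !polyCM. Qed.
HB.instance Definition _ :=
  GRing.isZmodMorphism.Build K {poly {poly {poly K}}} polyCCC polyCCC_zmod.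
HB.instance Definition _ :=
  GRing.isMonoidMorphism.Build K {poly {poly {poly K}}} polyCCC polyCCC_monoid.

(** The substitution of U t^al for U and V t^be for V. The parameter t is the outermost of the three
    variables, so that [.[0]] is the specialization t = 0. *)
Definition deform (al be : nat) : {poly {poly K}} -> {poly {poly {poly K}}} :=
  @bieval K {poly {poly {poly K}}} polyCCC
    ('X%:P%:P * 'X ^+ al) ('X%:P * 'X ^+ be).
HB.instance Definition _ al be := GRing.RMorphism.on (deform al be).

Lemma deform_face al be m f :
  (forall q p, f`_q`_p != 0 -> (m <= al * p + be * q)%N) ->
  exists f' : {poly {poly {poly K}}}, deform al be f = 'X^m * f' /\ f'.[0] = face al be m f.
Proof.
move=> hm.
exists (\sum_(q < size f) \sum_(p < size f`_q)
   ((f`_q`_p)%:P%:P * 'X%:P ^+ p * 'X ^+ q)%:P * 'X^(al * p + be * q - m)).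
split.
  rewrite /deform bieval_sum mulr_sumr; apply: eq_bigr => q _.
  rewrite mulr_sumr; apply: eq_bigr => p _ /=.
  have [->|/hm le] := eqVneq f`_q`_p 0.
    by rewrite !(rmorph0, mul0r, mulr0).
  rewrite mulrCA -exprD subnKC // [LHS]monomial_regroup; congr (_ * _).
  by rewrite /= /polyCCC !(rmorphM, rmorphXn).
rewrite horner_sum /face [RHS]poly_def; apply: eq_bigr => q _.
rewrite horner_sum poly_def scaler_suml; apply: eq_bigr => p _.
rewrite hornerM hornerC hornerXn expr0n.
have [->|/hm le] := eqVneq f`_q`_p 0; first by rewrite !mul0r if_same !scale0r.
rewrite subn_eq0 eqn_leq le andbT; case: ifP => _.
  by rewrite mulr1 -!mul_polyC !(rmorphM, rmorphXn) /=.
by rewrite mulr0 scale0r scale0r.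
Qed.

Lemma coef_face al be m f q p :
  (face al be m f)`_q`_p = if (al * p + be * q == m)%N then f`_q`_p else 0.
Proof.
rewrite /face coef_poly; case: ltnP => [_|le].
  by rewrite coef_poly; case: ltnP => // le; rewrite [f`_q`_p]nth_default // if_same.
by rewrite [f`_q]nth_default // coef0 if_same.
Qed.

End Newton.

Section NewtonEdge.
Variable K : closedFieldType.
Implicit Types (f : {poly {poly K}}).

(* The edge leaving the first monomial V^k of f(0, V) that minimizes the slope
   p / (k - q) over the monomials U^p V^q with q < k. *)
Lemma newton_polygon_edge f n :
  f`_0 != 0 -> f`_0`_0 = 0 -> f`_n`_0 != 0 ->
  exists al be m, [/\ (0 < al)%N, (0 < be)%N,
    forall q p, f`_q`_p != 0 -> (m <= al * p + be * q)%N,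
    face al be m f != 0 &
    exists2 z, z != 0 & bieval idfun 1 z (face al be m f) = 0].
Proof.
move=> f0 f00 fn0; have exk : exists k, f`_k`_0 != 0 by exists n.
case: (ex_minnP exk) => k fk0 kmin.
have k_gt0 : (0 < k)%N by rewrite lt0n; apply: contraTneq fk0 => ->; rewrite f00 eqxx.
have ltM q p : f`_q`_p != 0 -> (p < sizeY f)%N.
  move=> fqp; apply: leq_trans (max_size_coefXY f q); rewrite ltnNge.
  by apply: contra fqp => le; rewrite nth_default.
have f0l : f`_0`_(size f`_0).-1 != 0 by rewrite -lead_coefE lead_coef_eq0.
(* The bound [sizeY f] on the exponents of U lets the slope be minimized over a finite type. *)
pose P (x : 'I_k * 'I_(sizeY f)) := f`_(x.1)`_(x.2) != 0.
pose slope (x : 'I_k * 'I_(sizeY f)) : rat := (x.2)%:R / (k - x.1)%:R.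
have Px0 : P (Ordinal k_gt0, Ordinal (ltM _ _ f0l)) by [].
case: (arg_minP slope Px0) => -[[q0 ltq0] [p0 ltp0]]; rewrite /P /slope /= => f_qp0 minqp.
have minq q p : (q < k)%N -> f`_q`_p != 0 -> (p0 * (k - q) <= p * (k - q0))%N.
  move=> ltq fqp; have := minqp (Ordinal ltq, Ordinal (ltM _ _ fqp)) fqp; rewrite /=.
  rewrite ler_pdivrMr ?ltr0n ?subn_gt0 // mulrAC ler_pdivlMr ?ltr0n ?subn_gt0 //.
  by rewrite -!natrM ler_nat.
have p0_gt0 : (0 < p0)%N.
  rewrite lt0n; apply: contraTneq (ltq0) => p00; rewrite -leqNgt; apply: kmin.
  by rewrite -p00.
have face0 : face (k - q0) p0 (k * p0) f != 0.
  apply/eqP => /(congr1 (fun g : {poly {poly K}} => g`_k`_0)).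
  by rewrite coef_face muln0 add0n mulnC eqxx !coef0; apply/eqP.
(* These weights are normal to the edge from U^p0 V^q0 to V^k: both ends have weighted degree k
   p0. *)
exists (k - q0)%N, p0, (k * p0)%N; split=> //; first by rewrite subn_gt0.
  move=> q p fqp; have [ltq|leq] := ltnP q k; last by nia.
  by have := minq q p ltq fqp; nia.
(* On the edge the exponent of V determines that of U, so U = 1 causes no cancellation, and the ends
   of the edge keep nonzero coefficients at V^q0 and V^k. *)
pose g : {poly K} := bieval polyC 1%:P 'X (face (k - q0) p0 (k * p0) f).
have gE q : g`_q = ((face (k - q0) p0 (k * p0) f)`_q).[1].
  by rewrite /g bieval_map_horner coef_map.
have gk : g`_k != 0.
  rewrite gE (_ : _`_k = (f`_k`_0)%:P) ?hornerC //; apply/polyP => p.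
  rewrite coef_face coefC; have [->|pn0] := eqVneq p 0%N.
    by rewrite muln0 add0n mulnC eqxx.
  by case: eqP => // e; exfalso; nia.
have gq0 : g`_q0 != 0.
  rewrite gE (_ : _`_q0 = f`_q0`_p0 *: 'X^p0).
    by rewrite hornerZ hornerXn expr1n mulr1.
  apply/polyP => p; rewrite coef_face coefZ coefXn; have [->|pn0] := eqVneq p p0.
    by rewrite mulr1 (_ : _ == _ = true) //; apply/eqP; nia.
  by rewrite mulr0; case: eqP => // e; exfalso; apply/negP: pn0; nia.
have [z z0 rz] := nonmonomial_root ltq0 gq0 gk; exists z => //.
move/rootP: rz => rz; rewrite -[RHS]rz.
rewrite -[RHS]/(horner_eval z g) /g.
rewrite (@bieval_comp _ _ _ _ idfun) => [|c]; last by rewrite /= /horner_eval hornerC.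
by rewrite /= /horner_eval hornerC hornerX.
Qed.
End NewtonEdge.

Local Notation expo := 'rV[int]_4.

(** * Evaluation of Laurent polynomials and of initial terms *)

Section Evaluation.
Variables (K : comNzRingType).
Implicit Types (g h : laurent K) (nu mu : expo).

Lemma lcoef0 nu : coef nu (0 : laurent K) = 0.
Proof. exact: monalg.mcoeff0. Qed.
Lemma lcoefD nu g h : coef nu (g + h) = coef nu g + coef nu h.
Proof. exact: monalg.mcoeffD. Qed.
Lemma lcoefN nu g : coef nu (- g) = - coef nu g.
Proof. exact: monalg.mcoeffN. Qed.
Lemma coef_monom nu (c : K) mu : coef nu (monom c mu) = c *+ (mu == nu).
Proof. exact: monalg.mcoeffU. Qed.
Lemma lsuppP nu g : (nu \in lsupp g) = (coef nu g != 0).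
Proof. by rewrite /lsupp /coef monalg.mcoeff_neq0. Qed.
Lemma coef_sum_fset (I : Type) (r : seq I) (P : pred I) (F : I -> laurent K) nu :
  coef nu (\sum_(i <- r | P i) F i) = \sum_(i <- r | P i) coef nu (F i).
Proof.
by elim/big_rec2: _ => [|i x y _ <-]; [exact: monalg.mcoeff0 | exact: lcoefD].
Qed.

Definition above (N : nat) g := forall nu, nu \in lsupp g -> forall i, 0 <= nu 0 i + N%:Z.

Lemma exists_above g : exists N, above N g.
Proof.
exists (\sum_(nu <- lsupp g) \sum_i absz ((nu : expo) 0%R i))%N => nu gnu i.
rewrite (big_fsetD1 nu) //= (bigD1 i) //=; lia.
Qed.

Lemma fset_sum_wide (M : nmodType) (d : {fset expo}) g (F : expo -> K -> M) :
  (forall nu, F nu 0 = 0) -> (lsupp g `<=` d)%fset ->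
  \sum_(nu <- lsupp g) F nu (coef nu g) = \sum_(nu <- d) F nu (coef nu g).
Proof.
move=> F0 le; rewrite (big_fset_incl _ le) // => nu _.
by rewrite lsuppP negbK => /eqP ->.
Qed.

Section Unit.
Variables (A : comUnitRingType) (iota : {rmorphism K -> A}) (X : 'I_4 -> A).

Definition power nu : A := \prod_i X i ^ nu 0 i.
Definition ev g : A := \sum_(nu <- lsupp g) iota (coef nu g) * power nu.

Lemma ev_wide (d : {fset expo}) g : (lsupp g `<=` d)%fset ->
  ev g = \sum_(nu <- d) iota (coef nu g) * power nu.
Proof.
move=> le; apply: (fset_sum_wide (F := fun nu c => iota c * power nu)) le.
by move=> nu; rewrite rmorph0 mul0r.
Qed.

Fact ev_zmod : zmod_morphism ev.
Proof.
move=> g h; pose d := (lsupp g `|` lsupp h)%fset.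
have le : (lsupp (g - h)%R `<=` d)%fset by exact: monalg.msuppB_le.
rewrite (ev_wide le) (ev_wide (fsubsetUl _ _ : (lsupp g `<=` d)%fset)).
rewrite (ev_wide (fsubsetUr _ _ : (lsupp h `<=` d)%fset)) -sumrB.
by apply: eq_bigr => nu _; rewrite lcoefD lcoefN rmorphB mulrBl.
Qed.
HB.instance Definition _ := GRing.isZmodMorphism.Build (laurent K) A ev ev_zmod.

Lemma ev_monom (c : K) nu : ev (monom c nu) = iota c * power nu.
Proof.
rewrite (ev_wide (d := [fset nu]%fset)); last exact: monalg.msuppU_le.
by rewrite big_seq_fset1 coef_monom eqxx.
Qed.

Hypothesis X_unit : forall i, X i \is a GRing.unit.

Lemma powerD nu mu : power (nu + mu) = power nu * power mu.
Proof.
rewrite /power -big_split; apply: eq_bigr => i _.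
by rewrite mxE exprzDr.
Qed.

Lemma power0 : power 0 = 1.
Proof. by rewrite /power big1 // => i _; rewrite mxE. Qed.

Lemma power_delta i : power (delta_mx 0 i) = X i.
Proof.
rewrite /power (bigD1 i) //= big1 ?mulr1; first by rewrite mxE !eqxx.
by move=> j /negPf ji; rewrite mxE eqxx ji.
Qed.

Lemma ev_monoid : monoid_morphism ev.
Proof.
split; first by rewrite -[1]/(monom 1 0) ev_monom rmorph1 power0 mulr1.
move=> g h; elim/laurent_ind: g => [|g1 g2 e1 e2|a mu].
- by rewrite mul0r !raddf0 mul0r.
- by rewrite mulrDl !raddfD /= mulrDl e1 e2.
elim/laurent_ind: h => [|g1 g2 e1 e2|b nu].
- by rewrite mulr0 !raddf0 mulr0.
- by rewrite mulrDr !raddfD /= mulrDr e1 e2.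
rewrite -[monom a mu * _]/(laurent_mul _ _) monomM !ev_monom powerD rmorphM.
by rewrite mulrACA.
Qed.

End Unit.

Lemma eq_ev (A : comUnitRingType) (iA : {rmorphism K -> A}) (X Y : 'I_4 -> A) g :
  X =1 Y -> ev iA X g = ev iA Y g.
Proof.
by move=> e; apply: eq_bigr => nu _; congr (_ * _); apply: eq_bigr => i _; rewrite e.
Qed.

Lemma rmorph_ev (A B : comUnitRingType) (iA : {rmorphism K -> A}) (iB : {rmorphism K -> B})
    (f : {rmorphism A -> B}) X g : (forall i, X i \is a GRing.unit) ->
  (forall c, f (iA c) = iB c) -> f (ev iA X g) = ev iB (f \o X) g.
Proof.
move=> X_unit fi; rewrite rmorph_sum; apply: eq_bigr => nu _ /=.
rewrite rmorphM fi rmorph_prod; congr (_ * _).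
by apply: eq_bigr => i _; rewrite rmorphXz.
Qed.

Section Poly.
Variables (A : comNzRingType) (iota : {rmorphism K -> A}) (N : nat).
Variable (Y : 'I_4 -> A).

(* The value of g times the N-th power of all variables: no inverses are needed. *)
Definition pev g : A :=
  \sum_(nu <- lsupp g) iota (coef nu g) * \prod_i Y i ^+ absz ((nu : expo) 0 i + N%:Z).

End Poly.

Lemma pev_map (A B : comNzRingType) (iA : {rmorphism K -> A})
    (iB : {rmorphism K -> B}) (f : {rmorphism A -> B}) N Y g :
  (forall c, f (iA c) = iB c) ->
  f (pev iA N Y g) = pev iB N (f \o Y) g.
Proof.
move=> fi; rewrite rmorph_sum; apply: eq_bigr => nu _ /=.
rewrite rmorphM fi rmorph_prod; congr (_ * _).
by apply: eq_bigr => i _; rewrite rmorphXn.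
Qed.

Lemma pev_ev (A : comUnitRingType) (iA : {rmorphism K -> A}) N X g :
  (forall i, X i \is a GRing.unit) -> above N g ->
  pev iA N X g = (\prod_i X i) ^+ N * ev iA X g.
Proof.
move=> Xu ab; rewrite /pev /ev mulr_sumr big_seq [RHS]big_seq.
apply: eq_bigr => nu gnu; rewrite mulrCA; congr (_ * _).
rewrite /power -prodrXl -big_split; apply: eq_bigr => i _ /=.
rewrite -[X i ^+ N]/(X i ^ N) -exprzDr // [in RHS]addrC.
rewrite -[LHS]/(X i ^ (absz (nu 0 i + N%:Z) : int)).
by rewrite gez0_abs // ab.
Qed.

Lemma eq_pev (A : comNzRingType) (iA : {rmorphism K -> A}) N (Y Z : 'I_4 -> A) g :
  Y =1 Z -> pev iA N Y g = pev iA N Z g.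
Proof.
move=> e; apply: eq_bigr => nu _; congr (_ * _).
by apply: eq_bigr => i _; rewrite e.
Qed.

Section Initial.
Variable R : realType.

Lemma coef_initial (w : 'rV[R]_4) g nu :
  coef nu (initial_terms w g) =
  if all (fun mu => weight w nu <= weight w mu) (lsupp g) then coef nu g else 0.
Proof.
rewrite /initial_terms coef_sum_fset big_mkcond /=.
under eq_bigr => mu _.
  rewrite (_ : (if _ then _ else _) = (if all (fun mu' => weight w nu <= weight w mu') (lsupp g)
     then coef nu g else 0) *+ (mu == nu)); last first.
    rewrite coef_monom; have [->|_] := eqVneq mu nu; first by rewrite !mulr1n.
    by rewrite !mulr0n if_same.
  over.
have [gnu|gnu] := boolP (nu \in lsupp g).
  rewrite (big_fsetD1 nu) //= eqxx mulr1n big_seq big1 ?addr0 // => mu.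
  by rewrite !inE => /andP[/negPf ->].
rewrite big_seq big1 => [|mu gmu].
  by move: gnu; rewrite lsuppP negbK => /eqP ->; rewrite if_same.
by case: eqVneq gmu gnu => [-> ->|].
Qed.

(** Putting [Gam i * t^(w i)] for x_i multiplies the term of exponent nu by a power of t equal to
    its weight up to a shift common to all terms. The lowest power of t therefore collects exactly
    the initial terms. *)
Lemma pev_initial (A : comNzRingType) (iA : {rmorphism K -> A})
    (iAt : {rmorphism K -> {poly A}}) N (Gam : 'I_4 -> {poly A}) (w : 'I_4 -> nat) g :
  (forall c, iAt c = (iA c)%:P) -> above N g ->
  exists m G, pev iAt N (fun i => Gam i * 'X^(w i)) g = 'X^m * G /\
    G.[0] = pev iA N (fun i => (Gam i).[0])
              (initial_terms (\row_i (w i)%:R : 'rV[R]_4) g).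
Proof.
move=> iAtE ab; set W := \row_i _.
have init_le : (lsupp (initial_terms W g) `<=` lsupp g)%fset.
  apply/fsubsetP => nu; rewrite !lsuppP coef_initial; case: ifP => // _.
  by rewrite eqxx.
(* The weight shifted by N times the sum of the w_i: a natural number on the support of g, and
   ordered as the weight is. *)
pose n (nu : expo) := (\sum_i (w i * absz (nu 0 i + N%:Z)%R))%N.
have nE nu : nu \in lsupp g ->
    (n nu)%:R = weight W nu + \sum_i (w i * N)%:R :> R.
  move=> gnu; rewrite /n /weight -big_split natr_sum; apply: eq_bigr => i _ /=.
  rewrite mxE !natrM -mulrDr; congr (_ * _).
  by rewrite pmulrn gez0_abs ?ab // intrD.
have le_n nu mu : nu \in lsupp g -> mu \in lsupp g ->
    (weight W nu <= weight W mu) = (n nu <= n mu)%N.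
  by move=> gnu gmu; rewrite -(ler_nat R) !nE // lerD2r.
have [g0|[nu0 gnu0]] := fset_0Vmem (lsupp g).
  exists 0%N, 0; rewrite mulr0 horner0 /pev.
  have -> : lsupp (initial_terms W g) = fset0.
    by apply/eqP; rewrite -fsubset0 -g0.
  by rewrite g0 !big_seq_fset0.
have exm : exists m, has (fun nu => n nu == m) (lsupp g).
  by exists (n nu0); apply/hasP; exists nu0.
case: (ex_minnP exm) => m /hasP[nu1 gnu1 /eqP nu1m] minm.
have m_le nu : nu \in lsupp g -> (m <= n nu)%N.
  by move=> gnu; apply: minm; apply/hasP; exists nu.
have minE nu : nu \in lsupp g ->
    all (fun mu => weight W nu <= weight W mu) (lsupp g) = (n nu == m).
  move=> gnu; apply/allP/eqP => [/(_ _ gnu1)|e mu gmu]; last by rewrite le_n // e m_le.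
  by rewrite le_n // nu1m => le; apply/eqP; rewrite eqn_leq le m_le.
exists m, (\sum_(nu <- lsupp g) (iA (coef nu g))%:P *
  \prod_i Gam i ^+ absz ((nu : expo) 0 i + N%:Z) * 'X^(n nu - m)).
split.
  rewrite /pev mulr_sumr big_seq [RHS]big_seq; apply: eq_bigr => nu gnu.
  rewrite iAtE [in RHS]mulrCA -exprD subnKC ?m_le // -mulrA; congr (_ * _).
  rewrite /n expr_sum -big_split; apply: eq_bigr => i _ /=.
  by rewrite exprMn -exprM.
rewrite horner_sum [RHS](@fset_sum_wide _ (lsupp g) _ (fun nu c =>
  iA c * \prod_i (Gam i).[0] ^+ absz (nu 0 i + N%:Z))) //; last first.
  by move=> nu; rewrite rmorph0 mul0r.
rewrite big_seq [RHS]big_seq; apply: eq_bigr => nu gnu.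
rewrite coef_initial minE // !hornerM hornerC hornerXn expr0n subn_eq0.
rewrite (_ : (n nu <= m)%N = (n nu == m)); last by rewrite eqn_leq m_le ?andbT.
rewrite horner_prod; case: eqP => _; last by rewrite mulr0 raddf0 mul0r.
by rewrite mulr1; congr (_ * _); apply: eq_bigr => i _; rewrite horner_exp.
Qed.

End Initial.
End Evaluation.

(** * Zeros of initial ideals *)

Section InitialKernel.
Variables (R : realType) (K : closedFieldType).

Lemma ev_ker_is_ideal (A : comUnitRingType) (iA : {rmorphism K -> A}) X :
  (forall i, X i \is a GRing.unit) ->
  is_ideal [set g : laurent0 K | ev iA X (val g) = 0].
Proof.
move=> Xu; have [ev1 evM] := ev_monoid iA Xu.
rewrite /mkset; split=> [|f g f0 g0|f g g0]; first by rewrite !raddf0.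
  by rewrite !raddfD [X in X + _]f0 [X in _ + X]g0 addr0.
by rewrite rmorphM evM [X in _ * X]g0 mulr0.
Qed.

(** Vanishing at X defines an ideal, so the generators suffice. The ring A is general because three
    are used: K shows that an initial ideal is proper, K(z) finds its components, and the dual
    numbers over K(z) find multiplicities. *)
Lemma initial_ideal_ker (A : comUnitRingType) (iA : {rmorphism K -> A}) X
    (w : 'rV[R]_4) (P : ideal (laurent0 K)) :
  (forall i, X i \is a GRing.unit) ->
  (forall g, ideal_set P g -> ev iA X (initial_terms w (val g)) = 0) ->
  forall h, ideal_set (initial_ideal w P) h -> ev iA X (val h) = 0.
Proof.
move=> Xu gen h /(_ (Ideal (ev_ker_is_ideal iA Xu))); apply.
by move=> _ [g Pg <-]; exact: gen.
Qed.

(* The values x, x', y at a, a', c and y' at the remaining index. *)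
Definition pt (T : Type) (a a' c : 'I_4) (x x' y y' : T) (i : 'I_4) : T :=
  if i == a then x else if i == a' then x' else if i == c then y else y'.

(* The four indices.  They give the chart with coordinates U = X_a and V = X_c on
   the plane, for points normalized by X_a + X_a' = 1, that is X_c + X_c' = -1. *)
Definition cover (a a' c c' : 'I_4) := uniq [:: a; a'; c; c'].

Lemma coverP a a' c c' i : cover a a' c c' -> [|| i == a, i == a', i == c | i == c'].
Proof.
move=> u; have [||_ /(_ i)] := uniq_min_size (s2 := enum 'I_4) u.
- by move=> j _; rewrite mem_enum.
- by rewrite size_enum_ord.
- by rewrite mem_enum !inE => /esym.
Qed.

Lemma coverC a a' c c' : cover a a' c c' -> cover c c' a a'.
Proof. by rewrite /cover (uniq_catC [:: a; a'] [:: c; c']). Qed.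

Lemma cover_swap a a' c c' : cover a a' c c' -> cover a' a c c'.
Proof.
by rewrite /cover /= !inE [a' == a]eq_sym; do 6?case: (_ == _).
Qed.

Lemma pt_map (T U : Type) (f : T -> U) a a' c x x' y y' i :
  f (pt a a' c x x' y y' i) = pt a a' c (f x) (f x') (f y) (f y') i.
Proof. by rewrite /pt; do !case: ifP. Qed.

Lemma pt_affine (D B : comNzRingType) (f : {rmorphism D -> B}) a a' c u s v t i :
  f (pt a a' c u (1 - s) v (- 1 - t) i) =
  pt a a' c (f u) (1 - f s) (f v) (- 1 - f t) i.
Proof. by rewrite (pt_map f) !(rmorphB, rmorphN, rmorph1). Qed.

Lemma pt_affine1 (D B : comNzRingType) (h : {rmorphism D -> B}) a a' c u v t m :
  h (pt a a' c u 1 v (- 1 - t) m) = pt a a' c (h u) 1 (h v) (- 1 - h t) m.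
Proof. by rewrite (pt_map h) !(rmorphB, rmorphN, rmorph1). Qed.

Lemma pt_cover (T : Type) a a' c c' (t t' y y' : T) : cover a a' c c' ->
  let Z := pt a a' c t t' y y' in [/\ Z a = t, Z a' = t', Z c = y & Z c' = y'].
Proof.
rewrite /cover /= !inE !negb_or /pt !eqxx.
rewrite ![_ == a]eq_sym ![c' == _]eq_sym ![c == a']eq_sym.
move=> /and4P[/and3P[/negPf-> /negPf-> /negPf->] /andP[/negPf-> /negPf->] /negPf-> _].
by [].
Qed.

(** As al > 0, the term U t^al disappears at t = 0, whereas V t^be survives exactly for be = 0. This
    separates the inner points of a side from its corner. *)
Lemma pt_horner0 (D : comNzRingType) a a' c (u v : D) al be i : (0 < al)%N ->
  (pt a a' c u%:P (1 - u%:P * 'X ^+ al) v%:P (- 1 - v%:P * 'X ^+ be) i).[0] =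
  pt a a' c u (1 - 0) v (- 1 - v *+ (be == 0%N)) i.
Proof.
move=> al0; rewrite (pt_map (fun p => p.[0])) !hornerE !expr0n (gtn_eqF al0).
by rewrite mulr0 mulr_natr.
Qed.

Lemma pt_mulX (D : comNzRingType) a a' c (x x' y y' : {poly D}) al be i :
  pt a a' c x x' y y' i * 'X^(pt a a' c al 0 be 0 i)%N =
  pt a a' c (x * 'X^al) x' (y * 'X^be) y' i.
Proof. by rewrite /pt; do !case: ifP => _; rewrite ?mulr1. Qed.

Lemma pt_ext (T : Type) a a' c c' (X : 'I_4 -> T) i : cover a a' c c' ->
  X i = pt a a' c (X a) (X a') (X c) (X c') i.
Proof.
move=> /(coverP i); rewrite /pt; case: eqVneq => [->//|_]; case: eqVneq => [->//|_].
by case: eqVneq => [->//|_] /eqP ->.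
Qed.

(* Deforming (U, V) to (U t^al, V t^be) turns initial terms into lowest
   coefficients in t, which are multiplicative; and f divides every element of P
   once this element is written as a polynomial in U and V. *)
Lemma initial_terms_vanish (F : fieldType) (iF : {rmorphism K -> F}) X a a' c c'
    (f : {poly {poly K}}) al be m (f' : {poly {poly {poly K}}})
    (A : comUnitRingType) (iA : {rmorphism K -> A}) xi ze g :
  let eta := - 1 - ze *+ (be == 0%N) in
  let w : 'rV[R]_4 := \row_i (pt a a' c al 0 be 0 i)%:R in
  cover a a' c c' ->
  (forall i, X i != 0) -> X a + X a' = 1 -> X c + X c' = - 1 ->
  (forall G, bieval iF (X a) (X c) G = 0 -> exists h, G = h * f) ->
  (0 < al)%N -> deform al be f = 'X^m * f' -> f'.[0] != 0 \/ f' = 0 ->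
  xi \is a GRing.unit -> ze \is a GRing.unit -> eta \is a GRing.unit ->
  bieval iA xi ze f'.[0] = 0 ->
  ev iF X g = 0 -> ev iA (pt a a' c xi 1 ze eta) (initial_terms w g) = 0.
Proof.
move=> eta w cov X0 Xaa Xcc gen al0 fE f'0 xiu zeu etau root g0.
have [N ab] := exists_above g.
pose U : {poly {poly K}} := 'X%:P; pose V : {poly {poly K}} := 'X.
pose Y := pt a a' c U (1 - U) V (- 1 - V).
have Xu i : X i \is a GRing.unit by rewrite unitfE.
have : bieval iF (X a) (X c) (@pev K {poly {poly K}} (@polyCC K) N Y g) = 0.
  rewrite (@pev_map _ {poly {poly K}} F (@polyCC K) iF) => [|c0]; last exact: bievalCC.
  rewrite -[RHS](mulr0 ((\prod_i X i) ^+ N)) -g0 -pev_ev //.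
  apply: eq_pev => i; rewrite /= /Y pt_affine /U /V /= bievalY bievalX [RHS](pt_ext X i cov).
  by rewrite -Xcc -Xaa; congr (pt _ _ _ _ _ _ _ _); ring.
move=> /gen[h GE].
(* The deformed coordinates without their factor t^w_i. The coordinates a' and c' have weight 0 and
   keep their dependence on t. *)
pose Gam : 'I_4 -> {poly {poly {poly K}}} :=
  pt a a' c U%:P (1 - U%:P * 'X ^+ al) V%:P (- 1 - V%:P * 'X ^+ be).
have [|m1 [G [GE1 G0]]] := @pev_initial K R {poly {poly K}} (@polyCC K) (@polyCCC K) N Gam
  (pt a a' c al 0 be 0)%N g _ ab; first by [].
have : 'X^m1 * G = 'X^m * f' * deform al be h.
  rewrite -GE1 -fE mulrC -rmorphM -GE.
  rewrite (@pev_map _ {poly {poly K}} {poly {poly {poly K}}} (@polyCC K) (@polyCCC K)).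
    apply: eq_pev => i; rewrite [LHS]pt_mulX [RHS]pt_affine.
    have dU : deform al be U = U%:P * 'X^al by exact: bievalY.
    have dV : deform al be V = V%:P * 'X^be by exact: bievalX.
    by rewrite /= dU dV.
  exact: bievalCC.
move/lowest_coef_dvd => /(_ f'0)[e /(congr1 (bieval iA xi ze))].
rewrite rmorphM [X in _ = X * _]root mul0r G0.
rewrite (@pev_map _ {poly {poly K}} A (@polyCC K) iA) => [|c0]; last exact: bievalCC.
rewrite (@eq_pev _ _ _ _ _ (pt a a' c xi 1 ze eta)) => [|i]; last first.
  rewrite /= pt_horner0 // pt_affine /U /V /= bievalY.
  by rewrite rmorph0 subr0 rmorphMn /= bievalX.
have ab' : above N (initial_terms w g).
  move=> nu nug; apply: ab; move: nug; rewrite !lsuppP coef_initial.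
  by case: ifP => //; rewrite eqxx.
have ptu i : pt a a' c xi 1 ze eta i \is a GRing.unit.
  by rewrite /pt; do !case: ifP => _ //; rewrite unitr1.
rewrite pev_ev // => /(congr1 (fun x => ((\prod_i pt a a' c xi 1 ze eta i) ^+ N)^-1 * x)).
by rewrite mulr0 mulKr // unitrX // unitr_prod.
Qed.

End InitialKernel.

(** * Points of the plane curve on the coordinate lines *)

Section Charts.
Variables (R : realType) (K : closedFieldType) (P : ideal (laurent0 K)).
Variables (F : fieldType) (iF : {rmorphism K -> F}).

(** Used for changes of chart: the coordinates of one chart are affine functions of those of
    another. *)
Definition subst (p q : {poly {poly K}}) : {poly {poly K}} -> {poly {poly K}} :=
  @bieval K {poly {poly K}} (@polyCC K) p q.

Lemma bieval_subst (A : comNzRingType) (iA : {rmorphism K -> A}) u v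
    (p q G : {poly {poly K}}) :
  bieval iA u v (subst p q G) =
  bieval iA (bieval iA u v p) (bieval iA u v q) G.
Proof. by apply: bieval_comp => c; exact: bievalCC. Qed.

(** With weights (1, 0) only U is deformed, so t = 0 restricts f to the line U = 0, whatever the
    value xi of U. *)
Lemma bieval_edge (A : comNzRingType) (iA : {rmorphism K -> A}) xi ze f :
  bieval iA xi ze (deform 1 0 f).[0] = bieval iA 0 ze f.
Proof.
rewrite -[_.[0]]/(horner_eval 0 (deform 1 0 f)) /deform.
rewrite (@bieval_comp K _ {poly {poly K}} (@polyCCC K) (@polyCC K)) => [|c]; last first.
  by rewrite /= /horner_eval hornerC.
rewrite (bieval_comp (iota' := iA)) => [|c]; last exact: bievalCC.
by rewrite /= /horner_eval !hornerE /= rmorph0 bievalX.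
Qed.

Lemma bieval00 (f : {poly {poly K}}) : bieval idfun 0 0 f = f`_0`_0.
Proof.
rewrite -horner_coef0 -[f`_0]horner_coef0; symmetry.
apply: (bieval_uniq (h := horner_eval 0 \o horner_eval 0)) => [c||] /=;
by rewrite /horner_eval !(hornerC, hornerX).
Qed.

(** f is an equation of the plane curve with generic point (u, v). The case f = 0, of algebraically
    independent u and v, is included and has to be excluded separately. *)
Definition ker_gen u v (f : {poly {poly K}}) :=
  bieval iF u v f = 0 /\ forall G, bieval iF u v G = 0 -> exists h, G = h * f.

(** The kernel is prime: h vanishes at (u, v), hence is a multiple of f, and G is a unit of K[U, V].
    Applied to G = U - a and G = V - b, this shows that f is not identically zero on a line that
    does not contain the generic point. *)
Lemma ker_gen_factor u v f G h a b : ker_gen u v f -> f != 0 -> f = G * h ->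
  bieval iF u v G != 0 -> bieval idfun a b G != 0.
Proof.
move=> [f0 gen] fn0 fE Gn0; have : bieval iF u v h = 0.
  by move/eqP: f0; rewrite fE rmorphM mulf_eq0 (negPf Gn0) => /eqP.
move=> /gen[h' hE]; have e : G * h' = 1.
  by apply: (mulIf fn0); rewrite mul1r -mulrA -hE.
apply/eqP => G0; have := congr1 (bieval idfun a b) e.
by rewrite rmorphM rmorph1 /= G0 mul0r => /esym/eqP; rewrite oner_eq0.
Qed.

Lemma ker_gen_line u v f a : ker_gen u v f -> f != 0 -> u != iF a ->
  bieval polyC a%:P 'X f != 0.
Proof.
move=> gen f0 ua; apply/eqP => /bieval_eq0_dvdY[h fE].
have := ker_gen_factor a 0 gen f0 fE.
rewrite !bieval_subY subr_eq0 => /(_ ua).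
by rewrite subrr eqxx.
Qed.

Lemma ker_gen_line' u v f b : ker_gen u v f -> f != 0 -> v != iF b ->
  bieval polyC 'X b%:P f != 0.
Proof.
move=> gen f0 vb; apply/eqP => /bieval_eq0_dvdX[h]; rewrite mulrC => fE.
have := ker_gen_factor 0 b gen f0 fE.
rewrite !bieval_subX subr_eq0 => /(_ vb).
by rewrite subrr eqxx.
Qed.

(** A zero of P in the torus over F. The last condition, that it is not defined over K, is the form
    in which P having positive dimension is used. *)
Definition generic_point (X : 'I_4 -> F) :=
  [/\ forall i, X i != 0,
      forall g, ideal_set P g -> ev iF X (val g) = 0 &
      ~ exists Z, forall i, X i = iF (Z i)].

Definition weights (v : 'I_4 -> nat) : 'rV[R]_4 := \row_i (v i)%:R.

Variables (X : 'I_4 -> F).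
Hypothesis genX : generic_point X.

Section Chart.
Variables (a a' c c' : 'I_4).
Hypotheses (cov : cover a a' c c') (Xa : X a + X a' = 1) (Xc : X c + X c' = - 1).

Lemma exists_ker_gen : exists f, ker_gen (X a) (X c) f.
Proof.
case: genX => X0 XP Xnalg.
have [[f fgen]|[u [v [Xu Xv]]]] := bieval_ker_principal iF (X a) (X c).
  by exists f.
case: Xnalg; exists (pt a a' c u (1 - u) v (- 1 - v)) => i.
rewrite (pt_affine iF) -Xu -Xv (pt_ext X i cov).
by rewrite -Xc -Xa; congr (pt _ _ _ _ _ _ _ _); ring.
Qed.

(** A zero V = ze of f on the side U = 0, away from both corners, lies on the initial degeneration
    at e_a together with every invertible value xi of x_a. *)
Lemma initial_ideal_edge (A : comUnitRingType) (iA : {rmorphism K -> A}) f xi ze :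
  ker_gen (X a) (X c) f ->
  xi \is a GRing.unit -> ze \is a GRing.unit -> - 1 - ze \is a GRing.unit ->
  bieval iA 0 ze f = 0 ->
  forall h, ideal_set (initial_ideal (weights (pt a a' c 1 0 0 0)%N) P) h ->
  ev iA (pt a a' c xi 1 ze (- 1 - ze)) (val h) = 0.
Proof.
case: genX => X0 XP Xnalg gen xiu zeu etau f0.
have ptu i : pt a a' c xi 1 ze (- 1 - ze) i \is a GRing.unit.
  by rewrite /pt; do !case: ifP => _ //; rewrite unitr1.
apply: (initial_ideal_ker ptu) => g Pg.
apply: (@initial_terms_vanish R K F iF X a a' c c' f 1 0 0 (deform 1 0 f)) => //.
- by case: gen.
- by rewrite mul1r.
- have [->|fn0] := eqVneq f 0; [right|left]; first by rewrite rmorph0.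
  apply/eqP => /(congr1 (bieval polyC 0 'X)); rewrite bieval_edge rmorph0.
  by apply/eqP; apply: (ker_gen_line gen fn0); rewrite rmorph0.
- by rewrite bieval_edge.
- exact: XP.
Qed.

Lemma full_ideal_ev (A : comUnitRingType) (iA : {rmorphism K -> A}) (Z : 'I_4 -> A)
    (w : 'rV[R]_4) :
  (forall i, Z i \is a GRing.unit) ->
  initial_ideal w P = setT :> set _ ->
  ~ forall h, ideal_set (initial_ideal w P) h -> ev iA Z (val h) = 0.
Proof.
move=> Zu wT kerZ; have I1 : ideal_set (initial_ideal w P) 1 by rewrite wT.
by move/kerZ/eqP: I1; rewrite rmorph1 (ev_monoid iA Zu).1 oner_eq0.
Qed.

Lemma edge_nonvanishing f y : ker_gen (X a) (X c) f ->
  initial_ideal (weights (pt a a' c 1 0 0 0)%N) P = setT :> set _ ->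
  y != 0 -> - 1 - y != 0 -> bieval idfun 0 y f != 0.
Proof.
move=> gen wT y0 y1; apply/eqP => f0.
have yu : y \is a GRing.unit by rewrite unitfE.
have yu' : - 1 - y \is a GRing.unit by rewrite unitfE.
apply: (full_ideal_ev (iA := idfun) _ wT); last first.
  exact: (initial_ideal_edge gen (unitr1 _) yu yu' f0).
by move=> i; rewrite /pt; do !case: ifP => _ //; rewrite unitr1.
Qed.

(** At the corner x_a and x_c both vanish. The Newton edge gives a weight al e_a + be e_c interior
    to the cone, and a nonzero root z of its face polynomial at U = 1 gives the zero (1, 1, z, -1)
    of the initial ideal there. *)
Lemma corner_nonvanishing f : ker_gen (X a) (X c) f -> f != 0 ->
  (forall al be, (0 < al)%N -> (0 < be)%N ->
     initial_ideal (weights (pt a a' c al 0 be 0)%N) P = setT :> set _) ->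
  bieval idfun 0 0 f != 0.
Proof.
case: genX => X0 XP Xnalg gen fn0 wT; apply/eqP => f00.
have h00 : f`_0`_0 = 0 by rewrite -bieval00.
have f0 : f`_0 != 0.
  have := ker_gen_line' (b := 0) gen fn0.
  by rewrite bieval_horner polyC0 horner_coef0 rmorph0; apply.
have [n fn] : exists n, f`_n`_0 != 0.
  apply: contrapT => nex; have := ker_gen_line (a := 0) gen fn0.
  rewrite rmorph0 => /(_ (X0 a))/eqP; apply; rewrite bieval_map_horner.
  apply/polyP => n; rewrite coef_map coef0 /= /horner_eval horner_coef0.
  by apply: contrapT => /eqP ne; apply: nex; exists n.
have [al [be [m [al0 be0 hm face0 [z z0 fz]]]]] := newton_polygon_edge f0 h00 fn.
have [f' [f'E f'0]] := deform_face hm.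
have ptu i : pt a a' c 1 1 z (- 1 - z *+ (be == 0%N)) i \is a GRing.unit.
  rewrite gtn_eqF // mulr0n subr0 /pt.
  by do !case: ifP => _; rewrite ?unitrN ?unitr1 // unitfE.
apply: (full_ideal_ev (iA := idfun) ptu (wT _ _ al0 be0)).
apply: (initial_ideal_ker ptu) => g Pg.
apply: (@initial_terms_vanish R K F iF X a a' c c' f al be m f') => //.
- by case: gen.
- by left; rewrite f'0.
- exact: unitr1.
- by rewrite unitfE.
- by rewrite gtn_eqF // mulr0n subr0 unitrN unitr1.
- by rewrite f'0.
- exact: XP.
Qed.

End Chart.

Lemma exists_nondegenerate : exists2 y : K, y != 0 & - 1 - y != 0.
Proof.
(* This polynomial takes the value -1 at both 0 and -1, in every characteristic. *)
have [|y] := closed_rootP ('X^2 + 'X - 1 : {poly K}) _.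
  by rewrite -addrA size_polyDl size_polyXn // -[1]/(1%:P) size_XsubC.
rewrite rootE !hornerE => /eqP ry; exists y.
  by apply: contra_eqN ry => /eqP ->; rewrite expr0n !add0r oppr_eq0 oner_eq0.
apply: contra_eqN ry => /eqP e.
have -> : y ^+ 2 + y - 1 = (- 1 - y) * (- y) - 1 by ring.
by rewrite e mul0r add0r oppr_eq0 oner_eq0.
Qed.

(** The corner V = -1 is the origin of the chart with x_c' = -1 - V in place of V, where the curve
    has an equation of its own. This is why the conclusion offers some G vanishing on the curve
    instead of f. *)
Lemma side_nonvanishing a a' c c' y :
  cover a a' c c' -> X a + X a' = 1 -> X c + X c' = - 1 ->
  (forall al be, (0 < al)%N ->
     initial_ideal (weights (pt a a' c al 0 be 0)%N) P = setT :> set _) ->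
  (forall al be, (0 < al)%N ->
     initial_ideal (weights (pt a a' c' al 0 be 0)%N) P = setT :> set _) ->
  exists2 G, bieval iF (X a) (X c) G = 0 & bieval idfun 0 y G != 0.
Proof.
move=> cov Xa Xc wc wc'.
have [f gen] := exists_ker_gen cov Xa Xc.
(* If f were 0, it would vanish at the points of the side other than its corners, and there is such
   a point. *)
have fn0 : f != 0.
  have [z z0 z1] := exists_nondegenerate.
  apply: contraTneq (edge_nonvanishing cov Xa Xc gen (wc 1 0 isT)%N z0 z1).
  by move=> ->; rewrite rmorph0 eqxx.
have [->|y0] := eqVneq y 0.
  exists f; first by case: gen.
  by apply: (corner_nonvanishing cov Xa Xc gen fn0) => al be al0 _; exact: wc.
have [y1|y1] := eqVneq (- 1 - y) 0; last first.
  exists f; first by case: gen.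
  exact: (edge_nonvanishing cov Xa Xc gen (wc 1 0 isT)%N).
have cov' : cover a a' c' c.
  by move: cov; rewrite /cover /= !inE !negb_or [c' == c]eq_sym; do !case: eqP.
have Xc' : X c' + X c = - 1 by rewrite addrC.
have [f' gen'] := exists_ker_gen cov' Xa Xc'.
have f'n0 : f' != 0.
  have [z z0 z1] := exists_nondegenerate.
  apply: contraTneq (edge_nonvanishing cov' Xa Xc' gen' (wc' 1 0 isT)%N z0 z1).
  by move=> ->; rewrite rmorph0 eqxx.
exists (subst 'X%:P (- 1 - 'X) f').
  rewrite bieval_subst bievalY bieval_N1BX.
  by rewrite -Xc addrAC subrr add0r; case: gen'.
rewrite bieval_subst bievalY bieval_N1BX y1.
by apply: (corner_nonvanishing cov' Xa Xc' gen' f'n0) => al be al0 _; exact: wc'.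
Qed.

End Charts.

(** * The values of f around the square *)

Section MainChart.
Variables (R : realType) (K : closedFieldType) (P : ideal (laurent0 K)).
Variables (F : fieldType) (iF : {rmorphism K -> F}).

Lemma bieval_fixU (u v : K) f :
  (bieval polyC u%:P 'X f).[v] = bieval idfun u v f.
Proof.
rewrite -[LHS]/(horner_eval v _) (bieval_comp (iota' := idfun)) => [|c].
  by rewrite /= /horner_eval hornerC hornerX.
by rewrite /= /horner_eval hornerC.
Qed.

Lemma bieval_fixV (u v : K) f :
  (bieval polyC 'X v%:P f).[u] = bieval idfun u v f.
Proof.
rewrite -[LHS]/(horner_eval u _) (bieval_comp (iota' := idfun)) => [|c].
  by rewrite /= /horner_eval hornerC hornerX.
by rewrite /= /horner_eval hornerC.
Qed.

Lemma rootfree_const (p : {poly K}) x y : (forall z, p.[z] != 0) -> p.[x] = p.[y].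
Proof.
move=> nr; have [/size1_polyC ->|lt] := leqP (size p) 1; first by rewrite !hornerC.
have [|z /rootP rz] := closed_rootP p _; first by rewrite gtn_eqF.
by have := nr z; rewrite rz eqxx.
Qed.

Lemma ev_scale (A : fieldType) (iA : {rmorphism K -> A}) X (z : A) (g : laurent0 K) :
  z != 0 -> ev iA (fun i => z * X i) (val g) = ev iA X (val g).
Proof.
move=> z0; rewrite /ev big_seq [RHS]big_seq; apply: eq_bigr => nu gnu; congr (_ * _).
have /eqP d0 : expo_deg nu == 0 by case: g gnu => g /= /allP dg /dg.
rewrite /power; under eq_bigr do rewrite expfzMl.
rewrite big_split /= -(big_morph (fun n => z ^ n) (fun m n => expfzDr m n z0) (expr0z z)).
by rewrite [X in z ^ X]d0 expr0z mul1r.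
Qed.

Lemma generic_point_scale X z : generic_point P iF X -> z != 0 ->
  (exists z', z = iF z') -> generic_point P iF (fun i => z * X i).
Proof.
move=> [X0 XP Xnalg] z0 [z' zE]; split=> [i|g Pg|[Z ZE]].
- by rewrite mulf_neq0.
- by rewrite ev_scale // XP.
- apply: Xnalg; exists (fun i => z'^-1 * Z i) => i.
  by rewrite rmorphM fmorphV -zE -ZE mulKf.
Qed.

(* P has no tropical point in the cone of e_a and e_c, except possibly on the ray
   of e_c. *)
Definition misses_cone a a' c := forall al be, (0 < al)%N ->
  initial_ideal (weights R (pt a a' c al 0 be 0)%N) P = setT :> set _.

(* A polynomial without roots is constant, so f takes the same value along three
   sides of the square with vertices (0, 0), (1, 0), (1, -1), (0, -1). *)
Lemma main_chart X i j k l : generic_point P iF X -> cover l k i j ->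
  X l + X k = 1 -> X i + X j = - 1 ->
  misses_cone i j k -> misses_cone i j l -> misses_cone j i k -> misses_cone j i l ->
  misses_cone k l i -> misses_cone k l j ->
  exists f, [/\ ker_gen iF (X l) (X i) f,
    (bieval polyC 0%:P 'X f).[0] != 0 &
    (bieval polyC 0%:P 'X f).[0] = (bieval polyC 0%:P 'X f).[- 1]].
Proof.
move=> genX cov Xl Xi fijk fijl fjik fjil fkli fklj.
have [f fgen] := exists_ker_gen genX cov Xl Xi; exists f.
(* Each chart provides its own G; as a multiple of f, it can be nonzero only where f is. *)
have nz u v : (exists2 G, bieval iF (X l) (X i) G = 0 & bieval idfun u v G != 0) ->
    bieval idfun u v f != 0.
  move=> [G /(proj2 fgen)[h ->]]; rewrite rmorphM mulf_eq0 negb_or.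
  by case/andP.
have cov1 := coverC cov; have cov2 := cover_swap cov1; have cov3 := cover_swap cov.
(* A chart at e_i or e_j requires X_i + X_j = 1. The sign of all coordinates is changed, which
   leaves the values of elements of S_0 as they are. *)
have genN : generic_point P iF (fun i => - 1 * X i).
  by apply: generic_point_scale genX _ _; [|exists (- 1)];
    rewrite ?rmorphN ?rmorph1 ?oppr_eq0 ?oner_eq0.
have side_i u : bieval idfun u 0 f != 0.
  apply: nz.
  have [||G G0 Gn] := side_nonvanishing genN (- u) cov1 _ _ fijl fijk.
  - by rewrite -mulrDr Xi mulrNN mul1r.
  - by rewrite -mulrDr Xl mulr1.
  (* The coordinates of this chart are -x_i = -V and -x_l = -U. *)
  exists (subst (- 'X) (- 'X%:P) G); rewrite bieval_subst bieval_NX bieval_NY.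
    by rewrite -[- X i]mulN1r -[- X l]mulN1r.
  by rewrite oppr0.
have side_j u : bieval idfun u (- 1) f != 0.
  apply: nz.
  have [||G G0 Gn] := side_nonvanishing genN (- u) cov2 _ _ fjil fjik.
  - by rewrite -mulrDr addrC Xi mulrNN mul1r.
  - by rewrite -mulrDr Xl mulr1.
  (* The first coordinate is now -x_j = 1 + V. *)
  exists (subst (1 + 'X) (- 'X%:P) G); rewrite bieval_subst bieval_1DX bieval_NY.
    rewrite (_ : 1 + X i = - 1 * X j) -1?[- X l]mulN1r //.
    by rewrite -[X j](addKr (X i)) Xi; ring.
  by rewrite subrr.
have side_k v : bieval idfun 1 v f != 0.
  apply: nz.
  have Xk : X k + X l = 1 by rewrite addrC.
  have [G G0 Gn] := side_nonvanishing genX v cov3 Xk Xi fkli fklj.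
  exists (subst (1 - 'X%:P) 'X G); rewrite bieval_subst bieval_1BY bievalX.
    by rewrite -Xl addrAC subrr add0r.
  by rewrite subrr.
split=> //; first by rewrite bieval_fixU.
have constU v : (forall u, bieval idfun u v f != 0) ->
    bieval idfun 0 v f = bieval idfun 1 v f.
  by move=> nzv; rewrite -!bieval_fixV; apply: rootfree_const => u; rewrite bieval_fixV.
rewrite !bieval_fixU (constU 0) // (constU (- 1)) // -!bieval_fixU.
by apply: rootfree_const => v; rewrite bieval_fixU.
Qed.
End MainChart.

(** * The generic point of a prime *)

Section ResidueField.
Variables (A : comNzRingType) (P : prime_ideal A).

(** Localizing A / P at P itself gives the fraction field of A / P, the field of the generic
    point. *)
Definition residue_field := localization (prime_ideal_val P) P.
HB.instance Definition _ := GRing.ComPzRing.on residue_field.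

Definition rfrac (a : A) (s : denominator P) : residue_field :=
  Defs.frac (prime_ideal_val P) a s.

Let PM a b : ideal_set P b -> ideal_set P (a * b).
Proof. by case: (idealP P) => _ _; exact. Qed.

Lemma rfracE a s b t : rfrac a s = rfrac b t <-> ideal_set P (a * val t - b * val s).
Proof.
split=> [/Defs.fracP[u Pu]|Pab]; last by apply/Defs.fracP; exists (den1 P); exact: PM.
case: (Defs.primeP P) => _ /(_ _ _ Pu)[Pv|//]; by case: u {Pu} Pv => u /= /asboolP.
Qed.

Lemma rfrac0E : 0 = rfrac 0 (den1 P). Proof. by []. Qed.
Lemma rfrac1E : 1 = rfrac 1 (den1 P). Proof. by []. Qed.
Lemma rfracD a s b t : rfrac a s + rfrac b t = rfrac (a * val t + b * val s) (denM s t).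
Proof. exact: loc_addE. Qed.
Lemma rfracM a s b t : rfrac a s * rfrac b t = rfrac (a * b) (denM s t).
Proof. exact: loc_mulE. Qed.

Lemma rfrac_eq0 a s : rfrac a s = 0 <-> ideal_set P a.
Proof. by rewrite rfrac0E rfracE mul0r subr0 mulr1. Qed.

Fact residue_field_one_neq0 : 1 != 0 :> residue_field.
Proof. by apply/eqP; rewrite rfrac1E => /rfrac_eq0; case: (Defs.primeP P). Qed.
HB.instance Definition _ :=
  GRing.PzSemiRing_isNonZero.Build residue_field residue_field_one_neq0.

Definition residue_inv (p : residue_field) : residue_field :=
  match asboolP (~ ideal_set P (Defs.num p)) with
  | ReflectT h => rfrac (val (Defs.den p)) (Sub (Defs.num p) (asboolT h))
  | ReflectF _ => 0
  end.

Fact residue_mulVf (p : residue_field) : p != 0 -> residue_inv p * p = 1.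
Proof.
rewrite -{1 3}(Defs.fracE p) -/(rfrac _ _) => /eqP p0; rewrite /residue_inv.
case: (asboolP _) => [h|nP]; last by case: p0; apply/rfrac_eq0; exact: contrapT.
rewrite rfracM rfrac1E; apply/rfracE => /=; rewrite mulr1 mul1r mulrC subrr.
by case: (idealP P).
Qed.

Fact residue_inv0 : residue_inv 0 = 0.
Proof.
rewrite /residue_inv; case: (asboolP _) => // h; case: h.
by apply/(@rfrac_eq0 _ (Defs.den (0 : residue_field))); exact: Defs.fracE.
Qed.

HB.instance Definition _ :=
  GRing.ComNzRing_isField.Build residue_field residue_mulVf residue_inv0.

Definition residue (a : A) : residue_field := rfrac a (den1 P).

Fact residue_zmod : zmod_morphism residue.
Proof.
move=> a b; rewrite /residue -[- rfrac b _]/(loc_opp _) loc_oppE rfracD.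
by apply/rfracE; rewrite /= !mulr1 subrr; case: (idealP P).
Qed.
Fact residue_monoid : monoid_morphism residue.
Proof.
split=> // a b; rewrite /residue rfracM.
by apply/rfracE; rewrite /= !mulr1 subrr; case: (idealP P).
Qed.
HB.instance Definition _ :=
  GRing.isZmodMorphism.Build A residue_field residue residue_zmod.
HB.instance Definition _ :=
  GRing.isMonoidMorphism.Build A residue_field residue residue_monoid.

Lemma residue_eq0 a : residue a = 0 <-> ideal_set P a.
Proof. exact: rfrac_eq0. Qed.

End ResidueField.

Section GenericPoint.
Variables (K : closedFieldType) (b : 'I_4).
Lemma expo_degD (mu nu : expo) : expo_deg (mu + nu) = expo_deg mu + expo_deg nu.
Proof. by rewrite /expo_deg -big_split; apply: eq_bigr => i _; rewrite mxE. Qed.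

Lemma expo_degZ n (nu : expo) : expo_deg (n *: nu) = n * expo_deg nu.
Proof. by rewrite /expo_deg mulr_sumr; apply: eq_bigr => i _; rewrite mxE. Qed.

Lemma expo_deg_delta i : expo_deg (delta_mx 0 i) = 1.
Proof.
rewrite /expo_deg (bigD1 i) //= mxE !eqxx big1 ?addr0 // => j /negPf ji.
by rewrite mxE eqxx ji.
Qed.

(* Degree 0 by a power of the variable x_b. *)
Definition dehom (nu : expo) : expo := nu - expo_deg nu *: delta_mx 0 b.

Lemma dehomD : {morph dehom : mu nu / mu + nu}.
Proof. by move=> mu nu; rewrite /dehom expo_degD scalerDl opprD addrACA. Qed.

Lemma dehom_deg0 nu : expo_deg nu = 0 -> dehom nu = nu.
Proof. by move=> e; rewrite /dehom e scale0r subr0. Qed.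

Lemma dehom_degE nu : expo_deg (dehom nu) = 0.
Proof.
by rewrite /dehom -scaleN1r scalerA expo_degD expo_degZ expo_deg_delta mulr1 mulN1r subrr.
Qed.

Definition mono0 (c : K) nu : laurent0 K := Laurent0 (deg0_monom c (dehom_degE nu)).

Lemma val_mono0 c nu : val (mono0 c nu) = monom c (dehom nu). Proof. by []. Qed.

Lemma mono0M c d mu nu : mono0 (c * d) (mu + nu) = mono0 c mu * mono0 d nu.
Proof.
apply: val_inj; rewrite rmorphM !val_mono0 dehomD.
by rewrite -[RHS]/(laurent_mul _ _) monomM.
Qed.

Definition const0 (c : K) : laurent0 K := mono0 c 0.

Fact const0_zmod : zmod_morphism const0.
Proof.
move=> c d; apply: val_inj; rewrite raddfB /const0 !val_mono0.
exact: monalg.monalgUB.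
Qed.
Fact const0_monoid : monoid_morphism const0.
Proof.
split=> [|c d]; last by rewrite /const0 -[X in mono0 _ X]addr0 mono0M.
by apply: val_inj; rewrite /const0 val_mono0 dehom_deg0 // /expo_deg big1 // => i _; rewrite mxE.
Qed.
HB.instance Definition _ :=
  GRing.isZmodMorphism.Build K (laurent0 K) const0 const0_zmod.
HB.instance Definition _ :=
  GRing.isMonoidMorphism.Build K (laurent0 K) const0 const0_monoid.

Lemma laurent0_deg (g : laurent0 K) nu : nu \in lsupp (val g) -> expo_deg nu = 0.
Proof. by case: g => g /= /allP dg /dg/eqP. Qed.

Lemma laurent0E (g : laurent0 K) :
  g = \sum_(nu <- lsupp (val g)) const0 (coef nu (val g)) * mono0 1 nu.
Proof.
apply: val_inj; rewrite raddf_sum {1}(laurentE (val g)) big_seq [RHS]big_seq.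
apply: eq_bigr => nu gnu; rewrite -mono0M mulr1 add0r [RHS]val_mono0.
by rewrite (dehom_deg0 (laurent0_deg gnu)).
Qed.

Variable F : fieldType.

(** S_0 is generated by the constants and the invertible quotients x_i / x_b with their inverses, so
    a ring morphism to a field is evaluation at the images of these quotients. *)
Lemma laurent0_ev (res : {rmorphism laurent0 K -> F}) (g : laurent0 K) :
  (forall i, res (mono0 1 (delta_mx 0 i)) != 0) /\
  ev (res \o const0) (fun i => res (mono0 1 (delta_mx 0 i))) (val g) = res g.
Proof.
pose M nu := res (mono0 1 nu).
have MD mu nu : M (mu + nu) = M mu * M nu by rewrite /M -rmorphM -mono0M mulr1.
have M0 : M 0 = 1 by rewrite /M -[mono0 1 0]/(const0 1) !rmorph1.
have Mn0 nu : M nu != 0.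
  by apply/eqP => Mnu; have := oner_eq0 F; rewrite -M0 -(subrr nu) MD Mnu mul0r eqxx.
have MN nu : M (- nu) = (M nu)^-1.
  by apply: (mulIf (Mn0 nu)); rewrite -MD addNr M0 mulVf.
have MZn (n : nat) nu : M (n%:Z *: nu) = M nu ^ n.
  elim: n => [|n IHn]; first by rewrite scale0r M0.
  by rewrite intS scalerDl scale1r MD IHn expfzDr // expr1z.
have MZ (n : int) nu : M (n *: nu) = M nu ^ n.
  by case: n => n; rewrite ?MZn // NegzE scaleNr MN MZn -invr_expz.
split; first by move=> i; exact: Mn0.
rewrite [in RHS](laurent0E g) rmorph_sum /ev big_seq [RHS]big_seq.
apply: eq_bigr => nu gnu; rewrite rmorphM; congr (_ * _).
rewrite /power -/(M nu) [in RHS](row_sum_delta nu).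
rewrite (big_morph M MD M0); apply: eq_bigr => i _.
by rewrite MZ.
Qed.

End GenericPoint.

Section PrimePoint.
Variables (K : closedFieldType) (b : 'I_4) (P : prime_ideal (laurent0 K)).
Definition const_res : K -> residue_field P := residue P \o const0 b.
HB.instance Definition _ := GRing.RMorphism.on const_res.

Definition ratio (i : 'I_4) : laurent0 K := mono0 b 1 (delta_mx 0 i).
Definition res_point (i : 'I_4) : residue_field P := residue P (ratio i).

Lemma res_point_neq0 i : res_point i != 0.
Proof. exact: (laurent0_ev b (residue P) 0).1. Qed.

Lemma res_point_ev g : ev const_res res_point (val g) = residue P g.
Proof. exact: (laurent0_ev b (residue P) g).2. Qed.

Lemma res_pointP g : ideal_set P g <-> ev const_res res_point (val g) = 0.
Proof. by rewrite res_point_ev; split=> /residue_eq0. Qed.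

Lemma ratio_base : ratio b = 1.
Proof.
apply: val_inj; rewrite /ratio val_mono0 /dehom expo_deg_delta scale1r subrr.
by [].
Qed.

Lemma ratio_sum_L0 : ideal_set (L0_ideal K) (\sum_i ratio i).
Proof.
have -> : ideal_set (L0_ideal K) (\sum_i ratio i) =
    ideal_set (L_ideal K) (val (\sum_i ratio i)) by [].
have -> : val (\sum_i ratio i) = monom 1 (- delta_mx 0 b) * \sum_i @lvar K i.
  rewrite raddf_sum mulr_sumr; apply: eq_bigr => i _.
  rewrite -[RHS]/(laurent_mul _ _) monomM mulr1 [LHS]val_mono0 /dehom.
  by rewrite expo_deg_delta scale1r addrC.
by case: (idealP (L_ideal K)) => _ _ M; apply: M => J; apply.
Qed.

Lemma res_point_sum : L0_ideal K `<=` P -> \sum_i res_point i = 0.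
Proof.
by move=> LP; rewrite -rmorph_sum; apply/residue_eq0/LP; exact: ratio_sum_L0.
Qed.

(** With constant coordinates every q would be congruent to some c in K modulo P. For q in Q_1,
    either c = 0 and q lies in P, hence in Q_0, or c is a unit in Q_1; so no strict chain would
    start above P. *)
Lemma res_point_nonalg :
  prime_chain P 1 -> ~ exists Z, forall i, res_point i = const_res (Z i).
Proof.
move=> [Q [PQ Qchain]] [Z ZE].
have [Q01 nQ10] : Q 0%N `<` Q 1%N by exact: Qchain.
apply: nQ10 => q Q1q; pose c := ev idfun Z (val q).
have resq : residue P q = const_res c.
  rewrite -(res_point_ev q) /c; apply: esym.
  apply: (etrans (@rmorph_ev K K (residue_field P) idfun const_res const_res Z (val q) _ _)) => //.
    move=> i; rewrite unitfE; apply: contraNneq (res_point_neq0 i) => e.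
    by rewrite ZE e rmorph0.
  by apply: eq_ev => i; rewrite /= ZE.
have Pqc : ideal_set P (q - const0 b c).
  by apply/residue_eq0; rewrite rmorphB /= resq subrr.
have [c0|c0] := eqVneq c 0.
  by apply: (PQ 0%N isT); move: Pqc; rewrite c0 rmorph0 subr0.
have [_ Q1D Q1M] := idealP (Q 1%N).
case: (Defs.primeP (Q 1%N)) => + _; case.
have -> : 1 = const0 b c^-1 * (q + (- 1) * (q - const0 b c)).
  by rewrite mulN1r opprB addrC subrK -rmorphM mulVf ?rmorph1.
by apply/Q1M/Q1D => //; apply/Q1M; exact: (PQ 1%N isT).
Qed.

End PrimePoint.

(** * Multiplicity at a vertex *)

Section Supports.
Variables (K : closedFieldType).
Implicit Types (g h : laurent0 K) (nu : expo).

Definition supp_in (S : expo -> Prop) g := forall nu, nu \in lsupp (val g) -> S nu.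

Lemma supp_in0 (S : expo -> Prop) : supp_in S 0.
Proof. by move=> nu; rewrite lsuppP raddf0 lcoef0 eqxx. Qed.

Lemma supp_inD (S : expo -> Prop) g h : supp_in S g -> supp_in S h -> supp_in S (g + h).
Proof.
move=> Sg Sh nu; have := Sg nu; have := Sh nu; rewrite !lsuppP raddfD lcoefD.
case: eqVneq => [->|hn] Hh; last by rewrite ?hn; move: (Hh isT).
by rewrite addr0.
Qed.

Lemma supp_in_sum (S : expo -> Prop) (I : Type) (r : seq I) (p : pred I) (G : I -> laurent0 K) :
  (forall i, p i -> supp_in S (G i)) -> supp_in S (\sum_(i <- r | p i) G i).
Proof.
move=> SG; elim/big_rec: _ => [|i g pi Sg]; first exact: supp_in0.
by apply: supp_inD => //; exact: SG.
Qed.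

Lemma supp_inM (S T U : expo -> Prop) g h :
  (forall mu nu, S mu -> T nu -> U (mu + nu)) ->
  supp_in S g -> supp_in T h -> supp_in U (g * h).
Proof.
move=> STU Sg Th rho; rewrite lsuppP rmorphM -[_ * _]/(laurent_mul _ _) /laurent_mul.
rewrite coef_sum_fset; apply: contraNP => nU; rewrite big_seq big1 // => mu gmu.
rewrite coef_sum_fset big_seq big1 // => nu hnu; rewrite coef_monom.
have [e|] := eqVneq (mu + nu) rho; last by rewrite mulr0n.
by case: nU; rewrite -e; apply: STU; [exact: Sg|exact: Th].
Qed.

Lemma supp_in_mono0 (S : expo -> Prop) b c nu : S (dehom b nu) -> supp_in S (mono0 b c nu).
Proof.
move=> Snu mu; rewrite lsuppP [val _]val_mono0 coef_monom.
by case: (eqVneq (dehom b nu) mu) => [<- //|_]; rewrite mulr0n eqxx.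
Qed.

(** For this w the weight is the exponent of x_l, so g consists of terms of weight 0 and h of terms
    of weight at least 1; as g is not 0, the minimum 0 is attained. *)
Lemma initial_form_split (R : realType) (l : 'I_4) (w : 'rV[R]_4) g h :
  (forall nu, expo_deg nu = 0 -> weight w nu = (nu 0 l)%:~R) ->
  supp_in (fun nu => nu 0 l = 0) g -> supp_in (fun nu => 1 <= nu 0 l) h ->
  g != 0 -> initial_form w (g + h) = g.
Proof.
move=> wE Sg Sh g0; apply: val_inj; rewrite -[LHS]/(initial_terms w (val (g + h))).
have [nu0 gnu0] : exists nu0, nu0 \in lsupp (val g).
  case: (fset_0Vmem (lsupp (val g))) => [e|[nu0]]; last by exists nu0.
  by case/eqP: g0; apply: val_inj; rewrite [LHS]laurentE e big_seq_fset0 raddf0.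
have hcoef nu : nu \in lsupp (val g) -> coef nu (val h) = 0.
  move=> /Sg gnu; apply: contrapT => /eqP; rewrite -lsuppP => /Sh.
  by rewrite gnu.
apply/monalg.malgP => nu; rewrite -!/(coef _ _) coef_initial.
have wle mu : mu \in lsupp (val (g + h)) -> 0 <= weight w mu.
  move=> ghmu; rewrite wE ?(laurent0_deg ghmu) // ler0z.
  apply: (supp_inD (S := fun nu => 0 <= nu 0 l) _ _ ghmu).
    by move=> ? /Sg ->.
  by move=> ? /Sh; apply: le_trans.
have [gnu|gnu] := boolP (nu \in lsupp (val g)).
  rewrite ifT; first by rewrite raddfD lcoefD hcoef // addr0.
  apply/allP => mu ghmu; rewrite [weight w nu]wE ?(laurent0_deg gnu) // (Sg nu gnu).
  exact: wle.
have gnu0' : coef nu (val g) = 0 by move: gnu; rewrite lsuppP negbK => /eqP.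
rewrite gnu0'; case: ifP => // /allP/(_ nu0).
have -> : nu0 \in lsupp (val (g + h)).
  by rewrite lsuppP raddfD lcoefD hcoef // addr0 -lsuppP.
move=> /(_ isT); rewrite [weight w nu0]wE ?(laurent0_deg gnu0) // (Sg nu0 gnu0).
move=> lenu; rewrite raddfD lcoefD gnu0' add0r; apply: contrapT => /eqP.
rewrite -lsuppP => hnu; move: lenu; rewrite wE ?(laurent0_deg hnu) // lerz0.
by have := Sh nu hnu; lia.
Qed.

End Supports.

Section InitialAtVertex.
Variables (R : realType) (K : closedFieldType) (P : prime_ideal (laurent0 K)).
Variables (i j k l : 'I_4) (w : 'rV[R]_4).
Hypothesis cov : cover l k i j.
Hypothesis LP : L0_ideal K `<=` P.
Hypothesis wE : forall nu, expo_deg nu = 0 -> weight w nu = (nu 0 l)%:~R.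
Local Notation I := (initial_ideal w P).
Local Notation ratio := (@ratio K k).
Local Notation iF := (@const_res K k P).
Local Notation X := (@res_point K k P).

Lemma ideal0 (A : comPzRingType) (J : ideal A) : ideal_set J 0.
Proof. by case: (idealP J). Qed.
Lemma idealD (A : comPzRingType) (J : ideal A) a b :
  ideal_set J a -> ideal_set J b -> ideal_set J (a + b).
Proof. by case: (idealP J) => _ + _; exact. Qed.
Lemma idealM (A : comPzRingType) (J : ideal A) a b : ideal_set J b -> ideal_set J (a * b).
Proof. by case: (idealP J) => _ _; exact. Qed.
Lemma idealB (A : comPzRingType) (J : ideal A) a b :
  ideal_set J a -> ideal_set J b -> ideal_set J (a - b).
Proof. by move=> Ja Jb; apply: idealD => //; rewrite -mulN1r; exact: idealM. Qed.
Lemma prime_no1 (A : comPzRingType) (Q : prime_ideal A) : ~ ideal_set Q 1.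
Proof. by case: (Defs.primeP Q). Qed.
Lemma prime_prod (A : comPzRingType) (Q : prime_ideal A) (T : eqType) (r : seq T) (G : T -> A) :
  ideal_set Q (\prod_(x <- r) G x) -> exists2 x, x \in r & ideal_set Q (G x).
Proof.
elim: r => [|x r IHr]; first by rewrite big_nil => /prime_no1.
rewrite big_cons => /(proj2 (Defs.primeP Q))[Qx|/IHr[y yr Qy]].
  by exists x; rewrite ?mem_head.
by exists y; rewrite // inE yr orbT.
Qed.

Lemma sum_cover (M : nmodType) a a' c c' (G : 'I_4 -> M) :
  cover a a' c c' -> \sum_m G m = G a + G a' + G c + G c'.
Proof.
move=> u; rewrite -big_enum (perm_big [:: a; a'; c; c']) /=.
  by rewrite !big_cons big_nil addr0 !addrA.
apply: uniq_perm => //; first exact: enum_uniq.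
by move=> m; rewrite mem_enum !inE; apply/esym; exact: coverP.
Qed.

Lemma split_in_initial g h :
  supp_in (fun nu => nu 0 l = 0) g -> supp_in (fun nu => 1 <= nu 0 l) h ->
  ideal_set P (g + h) -> ideal_set I g.
Proof.
move=> Sg Sh Pgh; have [->|g0] := eqVneq g 0; first exact: ideal0.
by move=> J; apply; exists (g + h) => //; apply: (initial_form_split (l := l)).
Qed.

Lemma dehom_delta m nu : dehom k (delta_mx 0 m) 0 nu = (m == nu)%:R - (k == nu)%:R.
Proof.
by rewrite /dehom expo_deg_delta scale1r !mxE eqxx /= [nu == m]eq_sym [nu == k]eq_sym.
Qed.

Lemma l_neqs : [/\ l != k, l != i & l != j].
Proof. by move: cov; rewrite /cover /= !inE !negb_or => /andP[/and3P[]]. Qed.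

Lemma ratio_supp0 m : m != l -> supp_in (fun nu => nu 0 l = 0) (ratio m).
Proof.
move=> ml; apply: supp_in_mono0; rewrite dehom_delta (negPf ml).
by have [lk _ _] := l_neqs; rewrite [k == l]eq_sym (negPf lk) subrr.
Qed.

Lemma ratio_supp1 : supp_in (fun nu => nu 0 l = 1) (ratio l).
Proof.
apply: supp_in_mono0; rewrite dehom_delta eqxx.
by have [lk _ _] := l_neqs; rewrite [k == l]eq_sym (negPf lk) subr0.
Qed.

Lemma plane_in_initial : ideal_set I (ratio k + ratio i + ratio j).
Proof.
have [lk li lj] := l_neqs.
apply: (@split_in_initial _ (ratio l)).
- by apply: supp_inD; [apply: supp_inD|]; apply: ratio_supp0; rewrite eq_sym.
- by move=> nu /ratio_supp1 ->.
- apply: LP; have := @ratio_sum_L0 K k; rewrite (sum_cover _ cov).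
  by rewrite -!addrA addrC !addrA.
Qed.

Lemma plane_sum : X l + X k + (X i + X j) = 0.
Proof. by have := @res_point_sum K k P LP; rewrite (sum_cover _ cov) addrA. Qed.

(** Otherwise P contains (x_i + x_j) / x_k, which is free of x_l and so equals its own initial form.
    The initial form of the plane is (x_k + x_i + x_j) / x_k, and the difference of the two is 1. *)
Lemma sum_lk_neq0 (Q : prime_ideal (laurent0 K)) : I `<=` Q -> X l + X k != 0.
Proof.
move=> IQ; apply/eqP => Xlk; have [lk li lj] := l_neqs.
have Pij : ideal_set P (ratio i + ratio j).
  by apply/residue_eq0; rewrite rmorphD; have := plane_sum; rewrite Xlk add0r.
have Iij : ideal_set I (ratio i + ratio j).
  apply: (@split_in_initial _ 0); last by rewrite addr0.
    by apply: supp_inD; apply: ratio_supp0; rewrite eq_sym.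
  exact: supp_in0.
apply: (@prime_no1 _ Q); rewrite -(@ratio_base K k).
rewrite (_ : ratio k = ratio k + ratio i + ratio j - (ratio i + ratio j)); last by ring.
by apply: idealB; apply: IQ => //; exact: plane_in_initial.
Qed.

Section Slice.
Variables (f : {poly {poly K}}) (z : residue_field P).
Hypothesis zE : z * (X l + X k) = 1.
Hypothesis f0 : bieval iF (z * X l) (z * X i) f = 0.

Let s := ratio l.
Let r := ratio i.
Let zero (nu : expo) := nu 0 l = 0.
Let nonneg (nu : expo) := 0 <= nu 0 l.

Definition additive_pred (S : expo -> Prop) :=
  S 0 /\ forall mu nu, S mu -> S nu -> S (mu + nu).

Lemma zero_add : additive_pred zero.
Proof. by rewrite /zero; split=> [|mu nu]; rewrite mxE // => -> ->. Qed.

Lemma nonneg_add : additive_pred nonneg.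
Proof. by rewrite /nonneg; split=> [|mu nu]; rewrite mxE //; exact: addr_ge0. Qed.

Lemma supp_const (S : expo -> Prop) (c : K) : additive_pred S -> supp_in S (const0 k c).
Proof.
move=> [S0 _]; apply: supp_in_mono0.
by rewrite dehom_deg0 // /expo_deg big1 // => m _; rewrite mxE.
Qed.

Lemma supp_mul (S : expo -> Prop) (g h : laurent0 K) : additive_pred S ->
  supp_in S g -> supp_in S h -> supp_in S (g * h).
Proof. by move=> [_ SD]; apply: supp_inM. Qed.

Lemma supp_exp (S : expo -> Prop) (g : laurent0 K) n : additive_pred S ->
  supp_in S g -> supp_in S (g ^+ n).
Proof.
move=> SD Sg; elim: n => [|n IHn]; last by rewrite exprS; exact: supp_mul.
by rewrite expr0 -(rmorph1 (const0 k)); exact: supp_const.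
Qed.

Lemma nonneg_s : supp_in nonneg s.
Proof. by move=> nu /ratio_supp1; rewrite /nonneg => ->. Qed.

Lemma zero_r : supp_in zero r.
Proof. by apply: ratio_supp0; case: l_neqs => _; rewrite eq_sym. Qed.

Lemma nonneg_r : supp_in nonneg r.
Proof. by move=> nu /zero_r; rewrite /nonneg /zero => ->. Qed.

Lemma geometric (A : comNzRingType) (x : A) n :
  (1 + x) ^+ n = 1 + x * \sum_(m < n) (1 + x) ^+ m.
Proof. by rewrite -[LHS](subrK 1) subrX1 [RHS]addrC [1 + x - 1]addrC addKr. Qed.

(** Modulo s = x_l / x_k the left side is 0^p, which is 1 for p = 0. The cofactor h must have no
    negative power of x_l, so that s h has positive weight. *)
Lemma slice_step p n :
  exists2 h, supp_in nonneg h & s ^+ p * (1 + s) ^+ n = 0 ^+ p + s * h.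
Proof.
have S1 m : supp_in nonneg ((1 + s) ^+ m).
  apply: supp_exp nonneg_add _; apply: supp_inD; last exact: nonneg_s.
  by rewrite -(rmorph1 (const0 k)); exact: supp_const nonneg_add.
case: p => [|p].
  exists (\sum_(m < n) (1 + s) ^+ m); first by apply: supp_in_sum => m _; exact: S1.
  by rewrite !expr0 mul1r geometric.
exists (s ^+ p * (1 + s) ^+ n); first by
  apply: (supp_mul nonneg_add) => //; exact: supp_exp nonneg_add nonneg_s.
by rewrite expr0n add0r exprS mulrA.
Qed.

(** An upper bound of p + q over the monomials U^p V^q of f, so that N - p - q is never
    truncated. *)
Let N := (size f + sizeY f)%N.
(* (x_l + x_k)^N f(x_l / (x_l + x_k), x_i / (x_l + x_k)) / x_k^N. *)
Let homog : laurent0 K := \sum_(q < size f) \sum_(p < size f`_q)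
  const0 k f`_q`_p * r ^+ q * (s ^+ p * (1 + s) ^+ (N - p - q)).

Lemma dehomogenize_term (A : comNzRingType) (c S T y Y : A) p q n :
  (p + q <= n)%N -> y * Y = 1 ->
  c * T ^+ q * (S ^+ p * Y ^+ (n - p - q)) = Y ^+ n * (c * (y * S) ^+ p * (y * T) ^+ q).
Proof.
move=> le yY; rewrite -subnDA -{2}(subnK le) exprD.
transitivity (c * T ^+ q * (S ^+ p * Y ^+ (n - (p + q))) * (y * Y) ^+ (p + q)).
  by rewrite yY expr1n mulr1.
by rewrite !exprMn !exprD; ring.
Qed.

Lemma homog_in_P : ideal_set P homog.
Proof.
apply/residue_eq0; rewrite /homog.
have -> : residue P homog = (X l + X k) ^+ N * bieval iF (z * X l) (z * X i) f.
  rewrite bieval_sum mulr_sumr rmorph_sum; apply: eq_bigr => q _.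
  rewrite mulr_sumr rmorph_sum; apply: eq_bigr => p _.
  have le : (p + q <= N)%N.
    rewrite addnC leq_add //; first exact: ltnW.
    by apply: leq_trans (max_size_coefXY f q); exact: ltnW.
  rewrite !(rmorphM, rmorphXn) /= -[residue P (const0 k _)]/(iF _).
  have -> : residue P (1 + s) = X l + X k.
    by rewrite rmorphD -(@ratio_base K k) addrC.
  exact: dehomogenize_term.
by rewrite f0 mulr0.
Qed.

(** The part of [homog] free of x_l is f(0, x_i / x_k) = phi(x_i / x_k); the rest is a multiple of
    x_l / x_k and has positive weight. *)
Lemma slice_in_initial : ideal_set I (ueval (const0 k) r (bieval polyC 0%:P 'X f)).
Proof.
have -> : ueval (const0 k) r (bieval polyC 0%:P 'X f) = bieval (const0 k) 0 r f.
  rewrite (bieval_comp (iota' := const0 k)) => [|c]; last exact: uevalC.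
  by rewrite /= uevalX uevalC rmorph0.
have [h Sh hE] : exists2 h, supp_in nonneg h & homog = bieval (const0 k) 0 r f + s * h.
  rewrite bieval_sum /homog.
  elim/big_rec2: _ => [|q g g' _ [h Sh ->]].
    by exists 0; [exact: supp_in0|rewrite mulr0 addr0].
  have [h' Sh' ->] : exists2 h', supp_in nonneg h' &
      \sum_(p < size f`_q) const0 k f`_q`_p * r ^+ q * (s ^+ p * (1 + s) ^+ (N - p - q)) =
      \sum_(p < size f`_q) const0 k f`_q`_p * 0 ^+ p * r ^+ q + s * h'.
    elim/big_rec2: _ => [|p g1 g2 _ [h1 Sh1 ->]].
      by exists 0; [exact: supp_in0|rewrite mulr0 addr0].
    have [h2 Sh2 ->] := slice_step p (N - p - q).
    exists (const0 k f`_q`_p * r ^+ q * h2 + h1); last by ring.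
    apply: supp_inD => //; apply: (supp_mul nonneg_add) => //.
    apply: (supp_mul nonneg_add); first exact: supp_const nonneg_add.
    exact: supp_exp nonneg_add nonneg_r.
  exists (h' + h); first exact: supp_inD.
  by ring.
apply: (@split_in_initial _ (s * h)); last by rewrite -hE; exact: homog_in_P.
  rewrite bieval_sum; apply: supp_in_sum => q _; apply: supp_in_sum => p _.
  apply: (supp_mul zero_add); last exact: supp_exp zero_add zero_r.
  apply: (supp_mul zero_add); first exact: supp_const zero_add.
  exact: supp_exp zero_add (@supp_in0 _ _).
apply: (supp_inM (S := fun nu => nu 0 l = 1) (T := nonneg)) => //.
  by move=> mu nu; rewrite /nonneg mxE => ->; rewrite lerDl.
exact: ratio_supp1.
Qed.

End Slice.
End InitialAtVertex.

Section DualNumbers.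
Variable F : fieldType.

(* [(x, y)] stands for [x + y e] with [e ^ 2 = 0]. *)
Definition dual := (F * F)%type.
HB.instance Definition _ := GRing.Zmodule.on dual.
Implicit Types x y : dual.

Definition dual_mul x y : dual := (x.1 * y.1, x.1 * y.2 + x.2 * y.1).
Definition dual_one : dual := (1, 0).

Fact dual_mulA : associative dual_mul.
Proof. by move=> x y z; congr (_, _) => /=; ring. Qed.
Fact dual_mulC : commutative dual_mul.
Proof. by move=> x y; congr (_, _) => /=; ring. Qed.
Fact dual_mul1 : left_id dual_one dual_mul.
Proof. by move=> [a b]; congr (_, _) => /=; ring. Qed.
Fact dual_mulD : left_distributive dual_mul +%R.
Proof. by move=> x y z; congr (_, _) => /=; ring. Qed.
Fact dual_one_neq0 : dual_one != 0.
Proof. by apply/eqP => -[] /eqP; rewrite oner_eq0. Qed.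
HB.instance Definition _ := GRing.Zmodule_isComNzRing.Build dual
  dual_mulA dual_mulC dual_mul1 dual_mulD dual_one_neq0.

Definition dual_unit : pred dual := fun x => x.1 != 0.
Definition dual_inv x : dual :=
  if x.1 != 0 then (x.1^-1, - x.2 / x.1 ^+ 2) else x.

Fact dual_mulV : {in dual_unit, left_inverse 1 dual_inv *%R}.
Proof.
move=> x x0; rewrite /dual_inv ifT //; have {}x0 : x.1 != 0 by [].
by congr (_, _) => /=; field.
Qed.
Fact dual_unitP x y : y * x = 1 -> dual_unit x.
Proof.
move=> [e _]; rewrite /dual_unit; apply: contra_eqN e => /eqP ->.
by rewrite mulr0 eq_sym oner_eq0.
Qed.
Fact dual_inv_out : {in [predC dual_unit], dual_inv =1 id}.
Proof. by move=> x nu; rewrite /dual_inv ifN. Qed.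
HB.instance Definition _ := GRing.ComNzRing_hasMulInverse.Build dual
  dual_mulV dual_unitP dual_inv_out.

Lemma dual_unitE x : (x \is a GRing.unit) = (x.1 != 0). Proof. by []. Qed.

Definition dual_re x : F := x.1.
Fact dual_re_zmod : zmod_morphism dual_re. Proof. by []. Qed.
Fact dual_re_monoid : monoid_morphism dual_re. Proof. by []. Qed.
HB.instance Definition _ := GRing.isZmodMorphism.Build dual F dual_re dual_re_zmod.
HB.instance Definition _ :=
  GRing.isMonoidMorphism.Build dual F dual_re dual_re_monoid.

Definition dual_const (c : F) : dual := (c, 0).
Fact dual_const_zmod : zmod_morphism dual_const.
Proof. by move=> a b; congr (_, _) => /=; ring. Qed.
Fact dual_const_monoid : monoid_morphism dual_const.
Proof. by split=> // a b; congr (_, _) => /=; ring. Qed.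
HB.instance Definition _ := GRing.isZmodMorphism.Build F dual dual_const dual_const_zmod.
HB.instance Definition _ :=
  GRing.isMonoidMorphism.Build F dual dual_const dual_const_monoid.

End DualNumbers.

(** * Lower bounds for lengths and multiplicities *)

Section Length.
Variables (A : comPzRingType) (I : ideal A) (Q : prime_ideal A).
Hypothesis IQ : I `<=` Q.
Local Notation loc := (localization I Q).
Local Notation frac := (@Defs.frac A I Q).

Lemma denominatorP (u : denominator Q) : ~ ideal_set Q (val u).
Proof. by apply/asboolP; exact: (valP u). Qed.

Fact zero_is_ideal : is_ideal [set 0 : loc].
Proof.
split=> [//|x y|a x]; rewrite /mkset => -> //; last by rewrite mulr0.
by move=> ->; rewrite addr0.
Qed.

Fact unit_is_ideal (B : comPzRingType) : is_ideal [set: B].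
Proof. by []. Qed.

Fact frac_is_ideal : is_ideal [set p : loc | exists a s, ideal_set Q a /\ p = frac a s].
Proof.
have [Q0 QD QM] := idealP Q; split.
- by exists 0, (den1 Q).
- move=> _ _ [a [s [Qa ->]]] [b [t [Qb ->]]].
  exists (a * val t + b * val s), (denM s t); split; last exact: loc_addE.
  by apply: QD; rewrite mulrC; exact: QM.
- elim/Defs.frac_ind=> b t _ [a [s [Qa ->]]].
  by exists (b * a), (denM t s); split; [exact: QM|exact: loc_mulE].
Qed.

Lemma loc_frac_neq0 x (u : denominator Q) :
  (forall u, ~ ideal_set Q u -> ~ ideal_set I (u * x)) -> frac x u <> 0.
Proof.
move=> Ix /Defs.fracP[v]; rewrite mul0r subr0 mulr1 => Iv.
by apply: (Ix (val v)) => //; exact: denominatorP.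
Qed.

Lemma localization_chain1 : ideal_chain loc 1.
Proof.
exists (fun m => if m is 0%N then Ideal zero_is_ideal else Ideal (unit_is_ideal loc)).
case=> // _; split=> //= /(_ 1 Logic.I); apply: (@loc_frac_neq0 1 (den1 Q)).
by move=> u Qu; rewrite mulr1 => /IQ.
Qed.

(** The chain consists of 0, the maximal ideal and the whole ring. The first inclusion is strict
    because x / 1 is not 0, the second because I lies in Q. *)
Lemma localization_chain2 x : ideal_set Q x ->
  (forall u, ~ ideal_set Q u -> ~ ideal_set I (u * x)) -> ideal_chain loc 2.
Proof.
move=> Qx Ix; exists (fun m => match m with
  | 0 => Ideal zero_is_ideal | 1 => Ideal frac_is_ideal
  | _ => Ideal (unit_is_ideal loc) end)%N.
case=> [|[|//]] _; split=> //=.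
- by move=> _ ->; exists 0, (den1 Q); split; [case: (idealP Q)|].
- move=> sub; apply: (@loc_frac_neq0 x (den1 Q) Ix); apply: sub.
  by exists x, (den1 Q).
- move=> /(_ 1 Logic.I)[a [s [Qa /Defs.fracP[u /IQ]]]] /=.
  case: (Defs.primeP Q) => _ prQ /prQ[/denominatorP //|].
  rewrite mul1r mulr1 => Qsa; apply: (@denominatorP s).
  by rewrite -(subrK a (val s)); case: (idealP Q) => _ + _; apply.
Qed.

End Length.

Section TropMult.
Variables (R : realType) (K : closedFieldType) (P : prime_ideal (laurent0 K)).
Variable w : 'rV[R]_4.
Local Notation I := (initial_ideal w P).
Local Open Scope ereal_scope.

Lemma ring_length_ge (A : comPzRingType) n : ideal_chain A n -> n%:R%:E <= ring_length A R.
Proof. by move=> An; apply: ereal_sup_ubound; exists n. Qed.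

Lemma ring_length_ge0 (A : comPzRingType) : 0 <= ring_length A R.
Proof. by apply: (@ring_length_ge A 0); exists (fun=> Ideal (unit_is_ideal A)). Qed.

Lemma trop_mult_ge0 : 0 <= trop_mult P w.
Proof. by apply: esum_ge0 => Q _; exact: ring_length_ge0. Qed.

Lemma trop_mult_neq0 : trop_mult P w != 0 -> exists Q, minimal_prime I Q.
Proof.
move=> m0; apply: contrapT => nQ; case/eqP: m0; rewrite /trop_mult esum1 // => Q IQ.
by case: nQ; exists Q.
Qed.

Lemma trop_mult_ge2 (Q : prime_ideal (laurent0 K)) x :
  minimal_prime I Q -> ideal_set Q x ->
  (forall u, ~ ideal_set Q u -> ~ ideal_set I (u * x)%R) -> 2%:R%:E <= trop_mult P w.
Proof.
move=> minQ Qx Ix; apply: esum_ge; exists [set Q].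
  by split; [exact: finite_set1|move=> ? ->].
rewrite fsbig_set1; apply: ring_length_ge.
exact: (localization_chain2 (proj1 minQ) Qx Ix).
Qed.

Lemma trop_mult_ge2' (Q1 Q2 : prime_ideal (laurent0 K)) :
  minimal_prime I Q1 -> minimal_prime I Q2 -> Q1 <> Q2 -> 2%:R%:E <= trop_mult P w.
Proof.
move=> min1 min2 ne; apply: esum_ge; exists [set Q1; Q2].
  by split; [exact: finite_set2|move=> ? [->|->]].
rewrite (fsbigD1 Q1) /=; [|exact: finite_set2|by left].
rewrite (_ : _ `\ _ = [set Q2]).
  rewrite fsbig_set1 -[2%:R]/(1 + 1)%R EFinD; apply: leeD; apply: (ring_length_ge (n := 1)).
    exact: (localization_chain1 (proj1 min1)).
  exact: (localization_chain1 (proj1 min2)).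
apply/seteqP; split=> Q /= [].
  by move=> [->|->].
by move=> ->; split; [right|exact/nesym].
Qed.

End TropMult.

Section PointPrimes.
Variables (K : closedFieldType) (k : 'I_4).

Lemma ev_const (A : comUnitRingType) (iA : {rmorphism K -> A}) Z c :
  ev iA Z (val (const0 k c)) = iA c.
Proof.
rewrite /const0 val_mono0 ev_monom dehom_deg0.
  by rewrite power0 mulr1.
by rewrite /expo_deg big1 // => i _; rewrite mxE.
Qed.

Lemma ev_ratio (A : comUnitRingType) (iA : {rmorphism K -> A}) Z m :
  (forall i, Z i \is a GRing.unit) -> Z k = 1 -> ev iA Z (val (ratio K k m)) = Z m.
Proof.
move=> Zu Zk; rewrite /ratio val_mono0 ev_monom rmorph1 mul1r /dehom expo_deg_delta.
rewrite scale1r powerD // power_delta -[RHS]mulr1; congr (_ * _).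
apply: (mulIr (Zu k)); rewrite mul1r -[in LHS](power_delta Z k) -powerD // addNr power0.
by rewrite Zk.
Qed.

Lemma ev_ratio_sub (A : comUnitRingType) (iA : {rmorphism K -> A}) Z m c :
  (forall i, Z i \is a GRing.unit) -> Z k = 1 ->
  ev iA Z (val (ratio K k m - const0 k c)) = Z m - iA c.
Proof.
move=> Zu Zk; rewrite -(ev_const iA Z c) -(ev_ratio iA m Zu Zk).
by rewrite !raddfB.
Qed.

Variables (F : fieldType) (iF : {rmorphism K -> F}) (Z : 'I_4 -> F).
Hypothesis Zu : forall i, Z i \is a GRing.unit.

Fact point_is_prime : is_prime (Ideal (ev_ker_is_ideal iF Zu)).
Proof.
have [ev1 evM] := ev_monoid iF Zu.
split=> [|x y]; rewrite -[ideal_set _ _]/(ev iF Z (val _) = 0) => /eqP.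
  by rewrite rmorph1 ev1 oner_eq0.
by rewrite rmorphM evM mulf_eq0 => /orP[] /eqP; [left|right].
Qed.

Definition point_prime : prime_ideal (laurent0 K) := PrimeIdeal point_is_prime.

End PointPrimes.

(** * Components of the initial degeneration at e_l *)

Section Vertex.
Variables (R : realType) (K : closedFieldType) (P : prime_ideal (laurent0 K)).
Variables (i j k l : 'I_4).
Hypothesis cov : cover l k i j.
Hypothesis LP : L0_ideal K `<=` P.
Local Notation w := (weights R (pt l k i 1 0 0 0)%N).
Local Notation I := (initial_ideal w P).
Local Notation X := (@res_point K k P).
Local Notation iP := (@const_res K k P).

Lemma weight_vertex nu : weight w nu = (nu 0 l)%:~R.
Proof.
rewrite /weight (bigD1 l) //= big1 ?addr0 => [|m /negPf ml].
  by rewrite mxE /pt eqxx mul1r.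
by rewrite mxE /pt ml !if_same mul0r.
Qed.

Let wE nu : expo_deg nu = 0 -> weight w nu = (nu 0 l)%:~R.
Proof. by move=> _; exact: weight_vertex. Qed.

Variables (f : {poly {poly K}}) (z : residue_field P).
Hypothesis zE : z * (X l + X k) = 1.
Hypothesis genX : generic_point P iP (fun m => z * X m).
Hypothesis genf : ker_gen iP (z * X l) (z * X i) f.
Local Notation phi := (bieval polyC 0%:P 'X f).
Hypothesis phi0 : phi.[0] != 0.
Hypothesis phi01 : phi.[0] = phi.[- 1].

Lemma phi_neq0 : phi != 0.
Proof. by apply: contraNneq phi0 => ->; rewrite horner0. Qed.

(** Both ends V = 0 and V = -1 of the side carry the same nonzero value of phi, so every root gives
    invertible coordinates x_i = a and x_j = -1 - a. *)
Lemma phi_root a : root phi a -> a != 0 /\ - 1 - a != 0.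
Proof.
move=> /rootP ra; split; apply: contraNneq phi0 => e.
  by move: ra; rewrite e => ->.
have ae : a = - 1 by rewrite -[LHS](subKr (- 1)) e subr0.
by rewrite phi01; move: ra; rewrite ae => ->.
Qed.

(** phi(x_i / x_k) lies in Q and is a product of linear factors, one of which Q must contain. *)
Lemma initial_prime_root (Q : prime_ideal (laurent0 K)) : I `<=` Q ->
  exists2 a, root phi a & ideal_set Q (ratio K k i - const0 k a).
Proof.
move=> IQ; have := IQ _ (slice_in_initial cov wE zE (proj1 genf)).
have [r phiE] := closed_field_poly_normal phi.
rewrite {1}phiE -mul_polyC rmorphM /= uevalC rmorph_prod.
move=> /(proj2 (Defs.primeP Q))[Qc|].
  case: (@prime_no1 _ Q); rewrite -(rmorph1 (const0 k)).
  rewrite -(mulVf (_ : lead_coef phi != 0)) ?lead_coef_eq0 ?phi_neq0 //.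
  by rewrite rmorphM; exact: idealM.
move=> /prime_prod[a ar]; rewrite rmorphB /= uevalX uevalC => Qa.
by exists a => //; rewrite phiE rootZ ?lead_coef_eq0 ?phi_neq0 // root_prod_XsubC.
Qed.

Local Notation Kz := {fraction {poly K}}.

(** [Kz] is the function field K(z) of a line along which x_l = z varies freely. *)
Definition const_z : K -> Kz := (@FracField.tofrac {poly K}) \o polyC.
HB.instance Definition _ := GRing.RMorphism.on const_z.
Definition var_z : Kz := FracField.tofrac 'X.

Definition slice_point a : 'I_4 -> Kz :=
  pt l k i var_z 1 (const_z a) (- 1 - const_z a).

Lemma slice_point_unit a m : root phi a -> slice_point a m \is a GRing.unit.
Proof.
move=> /phi_root[a0 a1]; rewrite unitfE /slice_point /pt; case: ifP => _.
  by rewrite tofrac_eq0 polyX_eq0.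
case: ifP => _; first exact: oner_neq0.
case: ifP => _; first by rewrite fmorph_eq0.
by rewrite -(rmorph1 const_z) -rmorphN -rmorphB fmorph_eq0.
Qed.

(* The curve x_k = 1, x_i = a, x_j = - 1 - a with x_l free: these are the
   components of the initial degeneration of P at e_l. *)
Definition slice_prime a (ra : root phi a) : prime_ideal (laurent0 K) :=
  point_prime const_z (fun m => slice_point_unit m ra).

Lemma slice_primeE a (ra : root phi a) g :
  ideal_set (slice_prime ra) g = (ev const_z (slice_point a) (val g) = 0).
Proof. by []. Qed.

Lemma bieval_slice (A : comNzRingType) (iA : {rmorphism K -> A}) ze :
  bieval iA 0 ze f = ueval iA ze phi.
Proof.
rewrite (bieval_comp (iota' := iA)) => [|c]; last exact: uevalC.
by rewrite /= uevalX uevalC rmorph0.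
Qed.

Lemma initial_ideal_phi (A : comUnitRingType) (iA : {rmorphism K -> A}) xi ze :
  xi \is a GRing.unit -> ze \is a GRing.unit -> - 1 - ze \is a GRing.unit ->
  ueval iA ze phi = 0 -> forall h, ideal_set I h ->
  ev iA (pt l k i xi 1 ze (- 1 - ze)) (val h) = 0.
Proof.
move=> xiu zeu etau root0.
apply: (@initial_ideal_edge R K P _ iP _ genX l k i j cov _ _ A iA f) => //.
- by rewrite -mulrDr zE.
- have := plane_sum cov LP; rewrite addrC => /eqP; rewrite addr_eq0 => /eqP e.
  by rewrite -mulrDr e mulrN zE.
- by rewrite bieval_slice.
Qed.

Lemma ueval_phi (A : comNzRingType) (iA : {rmorphism K -> A}) ze a psi :
  phi = psi * ('X - a%:P) -> ueval iA ze phi = ueval iA ze psi * (ze - iA a).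
Proof.
by move=> ->; rewrite rmorphM rmorphB /= uevalX uevalC.
Qed.

Lemma initial_in_slice a (ra : root phi a) : I `<=` slice_prime ra.
Proof.
have pu m := slice_point_unit m ra; have [psi psiE] := factor_theorem _ _ ra.
have [sl sk si sj] := pt_cover var_z 1 (const_z a) (- 1 - const_z a) cov.
apply: initial_ideal_phi.
- by have := pu l; rewrite [slice_point a l]sl.
- by have := pu i; rewrite [slice_point a i]si.
- by have := pu j; rewrite [slice_point a j]sj.
- by rewrite (ueval_phi const_z (const_z a) psiE) subrr mulr0.
Qed.

Lemma ratio_slice a (ra : root phi a) b :
  ideal_set (slice_prime ra) (ratio K k i - const0 k b) -> a = b.
Proof.
have pu m := slice_point_unit m ra.
have [_ sk si _] := pt_cover var_z 1 (const_z a) (- 1 - const_z a) cov.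
rewrite slice_primeE ev_ratio_sub // /slice_point si => /eqP.
by rewrite subr_eq0 => /eqP/fmorph_inj.
Qed.

Lemma ratio_in_slice a (ra : root phi a) :
  ideal_set (slice_prime ra) (ratio K k i - const0 k a).
Proof.
have pu m := slice_point_unit m ra.
have [_ sk si _] := pt_cover var_z 1 (const_z a) (- 1 - const_z a) cov.
by rewrite slice_primeE ev_ratio_sub // [slice_point a i]si subrr.
Qed.

(** A prime Q between I and the slice prime contains x_i / x_k - b for some root b, and the
    inclusion forces b = a. Modulo Q the coordinates are then 1, a, -1 - a and some value of x_l, so
    Q contains whatever vanishes for a free x_l. *)
Lemma slice_minimal a (ra : root phi a) : minimal_prime I (slice_prime ra).
Proof.
split; first exact: initial_in_slice.
move=> Q IQ Qa g ag; have [b rb Qb] := initial_prime_root IQ.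
have ab : a = b by apply: (ratio_slice (ra := ra)); exact: Qa.
subst b; pose Y := @res_point K k Q; pose iQ := @const_res K k Q.
have Yk : Y k = 1 by rewrite /Y /res_point ratio_base rmorph1.
have Yi : Y i = iQ a.
  by move/residue_eq0/eqP: Qb; rewrite raddfB subr_eq0 => /eqP.
have Yj : Y j = - 1 - iQ a.
  have /residue_eq0 : ideal_set Q (ratio K k k + ratio K k i + ratio K k j).
    by apply: IQ; exact: (plane_in_initial cov LP wE).
  move=> e; have : Y k + Y i + Y j = 0 by rewrite -e !rmorphD.
  rewrite Yk Yi => /eqP.
  by rewrite addrC addr_eq0 => /eqP ->; rewrite opprD.
have [N ab] := exists_above (val g).
pose T : 'I_4 -> {poly K} := pt l k i 'X 1 a%:P (- 1 - a%:P).
(* With denominators cleared, vanishing over K(z) is an identity in K[z], which can be specialized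
   to the value of x_l modulo Q. *)
have T0 : pev polyC N T (val g) = 0.
  apply/eqP; rewrite -(tofrac_eq0 (pev polyC N T (val g))).
  rewrite (@pev_map K {poly K} Kz polyC const_z) //.
  rewrite (@eq_pev _ _ _ _ _ (slice_point a)) => [|m].
    rewrite pev_ev => [|m|//]; last exact: slice_point_unit.
    by move: ag; rewrite slice_primeE => ->; rewrite mulr0.
  exact: (pt_affine1 (@FracField.tofrac {poly K})).
have Y0 := @res_point_neq0 K k Q.
apply/(res_pointP k); rewrite -/Y -/iQ.
have : pev iQ N Y (val g) = 0.
  rewrite -[RHS](rmorph0 (ueval iQ (Y l))) -T0 (@pev_map K {poly K} _ polyC iQ) => [|c].
    apply: eq_pev => m; rewrite [LHS](pt_ext Y m cov) Yk Yi Yj /T /=.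
    by rewrite (pt_affine1 (ueval iQ (Y l))) /= uevalX uevalC.
  exact: uevalC.
rewrite pev_ev => [/eqP|m|//]; last by rewrite unitfE.
rewrite mulf_eq0 expf_eq0 => /orP[/andP[_ /prodf_eq0[m _]]|/eqP //].
by rewrite (negPf (Y0 m)).
Qed.

(** As a is a double root, phi(a + e) = 0 for e^2 = 0, so I vanishes at the dual point with x_i = a
    + e. There x_i / x_k - a has the value e, and if its product with u vanishes, so does u at the
    slice point. *)
Lemma slice_double a (ra : root phi a) psi :
  phi = psi * ('X - a%:P) -> root psi a ->
  forall u, ~ ideal_set (slice_prime ra) u ->
  ~ ideal_set I (u * (ratio K k i - const0 k a)).
Proof.
move=> phiE rpsi u nu Iu; apply: nu; rewrite slice_primeE.
pose iD : {rmorphism K -> dual Kz} := @dual_const Kz \o const_z.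
pose xi : dual Kz := dual_const var_z.
pose ze : dual Kz := (const_z a, 1).
pose Z := pt l k i xi 1 ze (- 1 - ze).
have Zre m : (Z m).1 = slice_point a m.
  exact: (pt_affine1 (@dual_re Kz)).
have Zu m : Z m \is a GRing.unit.
  by rewrite dual_unitE Zre -unitfE slice_point_unit.
have [Zl Zk Zi Zj] := pt_cover xi 1 ze (- 1 - ze) cov.
have [psi' psiE] := factor_theorem _ _ rpsi.
have zeE : ze - iD a = (0, 1) by congr (_, _) => /=; ring.
have : ev iD Z (val (u * (ratio K k i - const0 k a))) = 0.
  apply: initial_ideal_phi => //.
  - by have := Zu l; rewrite [Z l]Zl.
  - by have := Zu i; rewrite [Z i]Zi.
  - by have := Zu j; rewrite [Z j]Zj.
  - rewrite (ueval_phi iD ze phiE) psiE rmorphM rmorphB /= uevalX uevalC -mulrA.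
    rewrite [_ * (ze - _)](_ : _ = 0) ?mulr0 //.
    by rewrite zeE; congr (_, _) => /=; ring.
rewrite rmorphM (ev_monoid iD Zu).2 ev_ratio_sub // [Z i]Zi zeE.
move=> /(congr1 snd) /=; rewrite mulr1 mulr0 addr0 => u0.
rewrite -[RHS]u0 -[RHS]/(dual_re (ev iD Z (val u))).
rewrite (@rmorph_ev K (dual Kz) Kz iD const_z) //.
by apply: eq_ev => m; rewrite /= -Zre.
Qed.

Lemma trop_mult_slice : trop_mult P w != 0%E -> (2%:R%:E <= trop_mult P w)%E.
Proof.
move=> /trop_mult_neq0[Q [IQ _]].
have [a ra _] := initial_prime_root IQ.
have [psi psiE] := factor_theorem _ _ ra.
have psi0 : psi != 0 by apply: contraNneq phi_neq0 => e; rewrite psiE e mul0r.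
(* For psi = c the difference phi(0) - phi(-1) is c itself, in every characteristic. *)
have sz : size psi != 1.
  apply/negP => /size_poly1P[c c0 cE]; move: phi01.
  rewrite psiE cE !hornerE => /eqP; rewrite -subr_eq0.
  rewrite (_ : _ - _ = c); last by ring.
  by rewrite (negPf c0).
have [b rb] := closed_rootP psi sz.
(* For b = a a single local ring has length at least 2; otherwise two minimal primes contribute at
   least 1 each. *)
have [ab|nab] := eqVneq a b.
  subst b; apply: (trop_mult_ge2 (slice_minimal ra) (ratio_in_slice ra)).
  exact: (slice_double psiE rb).
have rb' : root phi b by rewrite psiE rootM rb.
apply: (trop_mult_ge2' (slice_minimal ra) (slice_minimal rb')) => e.
have := ratio_in_slice rb'; rewrite -e => /ratio_slice ab.
by rewrite ab eqxx in nab.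
Qed.

End Vertex.

(** * Tropical curves in the plane *)

Section Assembly.
Variables (R : realType) (K : closedFieldType).

(** The factor z need not come from K. Since X_k = 1 it equals z X_k, so if all z X_m were
    constants, their quotients X_m = z X_m / (z X_k) would be constants too. *)
Lemma generic_point_normalize (P : ideal (laurent0 K)) (F : fieldType)
    (iF : {rmorphism K -> F}) (X : 'I_4 -> F) k z :
  (forall m, X m != 0) -> (forall g, ideal_set P g -> ev iF X (val g) = 0) ->
  ~ (exists Z, forall m, X m = iF (Z m)) -> X k = 1 -> z != 0 ->
  generic_point P iF (fun m => z * X m).
Proof.
move=> X0 XP nalg Xk z0; split=> [m|g Pg|[Z ZE]]; first by rewrite mulf_neq0.
  by rewrite ev_scale // XP.
apply: nalg; exists (fun m => Z m / Z k) => m.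
by rewrite fmorph_div -!ZE Xk mulr1 mulrAC divff // mul1r.
Qed.

Lemma opp_of_sum (F : fieldType) (z a b : F) : z * a = 1 -> a + b = 0 -> z * b = - 1.
Proof. by move=> za /eqP; rewrite addrC addr_eq0 => /eqP ->; rewrite mulrN za. Qed.

Lemma trop_mult_vertex (P : prime_ideal (laurent0 K)) i j k l :
  cover l k i j -> L0_ideal K `<=` P -> prime_chain P 1 ->
  misses_cone R P i j k -> misses_cone R P i j l ->
  misses_cone R P j i k -> misses_cone R P j i l ->
  misses_cone R P k l i -> misses_cone R P k l j ->
  trop_mult P (weights R (pt l k i 1 0 0 0)%N) != 0%E ->
  (2%:R%:E <= trop_mult P (weights R (pt l k i 1 0 0 0)%N))%E.
Proof.
move=> cov LP chain fijk fijl fjik fjil fkli fklj m0.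
have wE nu : expo_deg nu = 0 ->
    weight (weights R (pt l k i 1 0 0 0)%N) nu = (nu 0 l)%:~R.
  by move=> _; exact: weight_vertex.
have [Q [IQ _]] := trop_mult_neq0 m0.
have Xlk : _ != 0 := sum_lk_neq0 cov LP wE IQ.
have zE := mulVf Xlk.
have genX := generic_point_normalize (@res_point_neq0 K k P)
  (fun g => proj1 (@res_pointP K k P g)) (res_point_nonalg chain)
  (etrans (congr1 (residue P) (ratio_base K k)) (rmorph1 (residue P)))
  (invr_neq0 Xlk).
have Xl := etrans (esym (mulrDr _ _ _)) zE.
have Xij := etrans (esym (mulrDr _ _ _)) (opp_of_sum zE (plane_sum cov LP)).
have [f [genf phi0 phi01]] :=
  main_chart genX cov Xl Xij fijk fijl fjik fjil fkli fklj.
exact: (trop_mult_slice cov LP zE genX genf phi0 phi01).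
Qed.

Lemma initial_ideal_eq_weight (w w' : 'rV[R]_4) (P : ideal (laurent0 K)) :
  (forall nu, expo_deg nu = 0 -> weight w nu = weight w' nu) ->
  initial_ideal w P = initial_ideal w' P.
Proof.
move=> ww'; have e : @initial_form K R w = @initial_form K R w'.
  apply/funext => g; apply: val_inj; apply/monalg.malgP => nu.
  rewrite -!/(coef _ _) -[LHS]/(coef nu (initial_terms w (val g))).
  rewrite -[RHS]/(coef nu (initial_terms w' (val g))) !coef_initial.
  have [gnu|gnu] := boolP (nu \in lsupp (val g)); last first.
    by move: gnu; rewrite lsuppP negbK => /eqP ->; rewrite !if_same.
  congr (if _ then _ else _); apply: eq_in_all => mu gmu.
  by rewrite (ww' _ (laurent0_deg gnu)) (ww' _ (laurent0_deg gmu)).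
by rewrite /initial_ideal e.
Qed.

Lemma trop_mult_eq_weight (w w' : 'rV[R]_4) (P : prime_ideal (laurent0 K)) :
  (forall nu, expo_deg nu = 0 -> weight w nu = weight w' nu) ->
  trop_mult P w = trop_mult P w'.
Proof. by move=> ww'; rewrite /trop_mult (initial_ideal_eq_weight P ww'). Qed.

(** The chosen representative is e_l plus some constant vector, whose contribution is that constant
    times the degree of nu, which is 0. *)
Lemma weight_lift (l : 'I_4) nu : expo_deg nu = 0 ->
  weight (lift_real R (cls_e int l)) nu = (nu 0 l)%:~R.
Proof.
move=> d0; have /clsP[c e] := cls_repr (cls_e int l).
have reprE m : repr (cls_e int l) 0 m = (m == l)%:R + c.
  have /matrixP/(_ 0 m) := e; rewrite !mxE eqxx /= => /eqP.
  by rewrite subr_eq addrC => /eqP.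
rewrite /weight /lift_real; under eq_bigr do rewrite mxE reprE -intrM mulrDl.
rewrite -(big_morph _ (intrD R) (erefl _ : (0 : int)%:~R = 0)) big_split /=.
rewrite -mulr_sumr -/(expo_deg nu) d0 mulr0 addr0; congr (_%:~R).
rewrite (bigD1 l) //= eqxx mul1r big1 ?addr0 // => m /negPf ->.
by rewrite mul0r.
Qed.

Lemma cls_mulrn (A : pzRingType) (v : 'rV[A]_4) n : cls v *+ n = cls (v *+ n).
Proof.
elim: n => [|n IHn]; last by rewrite !mulrS IHn clsD.
by rewrite !mulr0n; apply: (addrI (cls 0)); rewrite addr0 -clsD addr0.
Qed.

(** The difference of the coordinates l and m is well defined on classes and equals 1 on e_l, so n
    divides 1. *)
Lemma primitive_vertex (l m : 'I_4) : m != l -> primitive (cls_e int l).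
Proof.
move=> ml v n; rewrite -[v]cls_repr.
rewrite cls_mulrn.
move=> /clsP[c /matrixP e].
have e1 : (repr v 0 l - repr v 0 m) * n%:Z = 1.
  have el := e 0 l; have em := e 0 m.
  move: el em; rewrite !mxE !eqxx (negPf ml) /= !mulmxnE => <-.
  rewrite -[repr v 0 l *+ n]mulr_natr -[repr v 0 m *+ n]mulr_natr !natz mulrBl.
  by move: (repr v 0 l * n%:Z) (repr v 0 m * n%:Z) => x y; lia.
have := dvdz_mull (repr v 0 l - repr v 0 m) (dvdzz n%:Z).
by rewrite e1 dvdz1 => /eqP.
Qed.

Lemma cone2_coords x y (v : 'rV[R]_4) m m' :
  cone2 (cls_e R x) (cls_e R y) (cls v) ->
  m != x -> m != y -> m' != x -> m' != y -> v 0 m = v 0 m'.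
Proof.
move=> [a [b [_ _]]]; rewrite -![_ *: cls_e _ _]/(mod1_scale _ (cls _)) !mod1_scaleE.
rewrite -clsD => /clsP[d /matrixP e] mx my m'x m'y.
have := e 0 m; have := e 0 m'; rewrite !mxE !eqxx /=.
rewrite (negPf mx) (negPf my) (negPf m'x) (negPf m'y) !mulr0 !addr0 !subr0.
by move=> -> ->.
Qed.

(** Here v is al e_a. Comparing coordinates, all entries of a representative of u except the a-th
    agree, so u = n e_a with n > 0, and primitivity gives n = 1. *)
Lemma ray_vertex (u : mod1 int) (a : 'I_4) (al : nat) (v : 'rV[R]_4) :
  (0 < al)%N -> primitive u -> (forall m, v 0 m = (al * (m == a))%:R) ->
  ray u (cls v) -> u = cls_e int a.
Proof.
move=> al0 prim vE [r r_ge0]; rewrite -[_ *: cls _]/(mod1_scale _ (cls _)) mod1_scaleE.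
move=> /clsP[d /matrixP e].
have [b ba] : exists b, b != a.
  exists (if a == ord0 then ord_max else ord0).
  by case: (eqVneq a ord0) => [->|] //; rewrite eq_sym.
have eE m : r * (repr u 0 m)%:~R = (al * (m == a))%:R + d.
  by have := e 0 m; rewrite !mxE vE => /eqP; rewrite subr_eq addrC => /eqP.
have rn : r * (repr u 0 a - repr u 0 b)%:~R = al%:R.
  by rewrite rmorphB mulrBr !eE (negPf ba) eqxx muln0 muln1 add0r addrK.
have r_gt0 : 0 < r.
  rewrite lt0r r_ge0 andbT; apply: contra_eqN rn => /eqP ->.
  by rewrite mul0r eq_sym pnatr_eq0 -lt0n.
have xb m : m != a -> repr u 0 m = repr u 0 b.
  move=> ma; apply: (@intr_inj R); apply: (mulfI (lt0r_neq0 r_gt0)).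
  by rewrite !eE (negPf ma) (negPf ba).
have [n nE] : exists n : nat, repr u 0 a - repr u 0 b = n%:Z.
  have : 0 < repr u 0 a - repr u 0 b.
    by rewrite -(ltr0z R) -(pmulr_rgt0 _ r_gt0) rn ltr0n.
  by case: (_ - _) => // n _; exists n.
have uE : u = cls_e int a *+ n.
  rewrite -[LHS]cls_repr /cls_e cls_mulrn; apply/clsP; exists (repr u 0 b).
  apply/matrixP => p m; rewrite !mxE !ord1 !mulmxnE mxE eqxx /=.
  have [->|ma] := eqVneq m a; last by rewrite xb // mul0rn subr0.
  by rewrite natz -nE opprB addrC subrK.
by rewrite uE (prim _ _ uE).
Qed.

Variables (Y : effective_cycle_E K) (C : tropical_curve R).
Hypothesis YC : Trop_eq Y C.

Lemma initial_ideal_full (P : prime_ideal (laurent0 K)) (w : 'rV[R]_4) :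
  P \in finsupp (cycle_coef Y) -> ~ curve_supp C (cls w) ->
  initial_ideal w P = setT :> set _.
Proof.
move=> PY nC; apply: contrapT => nT; apply: nC; rewrite -(proj1 YC).
by exists P => //; exists w.
Qed.

Lemma vertex_notin_supp (a : 'I_4) (al : nat) (v : 'rV[R]_4) :
  mult C (cls_e int a) = 0%N -> (0 < al)%N ->
  (forall m, v 0 m = (al * (m == a))%:R) -> ~ curve_supp C (cls v).
Proof.
move=> Ca al0 vE [u uC uv].
have prim : primitive u by case: C uC => mC primC _ _ /= /primC.
move: uC; rewrite (ray_vertex al0 prim vE uv) mem_finsupp.
by rewrite Ca eqxx.
Qed.

Lemma cone2C (x y : mod1 R) : cone2 x y = cone2 y x.
Proof.
by apply/seteqP; split=> z [a [b [a0 b0 ->]]]; exists b, a; rewrite addrC.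
Qed.

(** The weight al e_a + be e_c is not in C: for be = 0 because the ray of e_a has multiplicity 0,
    and for be > 0 because the open cone of e_a and e_c meets neither of the two cones containing
    C. *)
Lemma full_chart (a a' c c' : 'I_4) (P : prime_ideal (laurent0 K)) :
  P \in finsupp (cycle_coef Y) -> cover a a' c c' ->
  curve_supp C `<=` cone2 (cls_e R a) (cls_e R a') `|` cone2 (cls_e R c) (cls_e R c') ->
  mult C (cls_e int a) = 0%N -> misses_cone R P a a' c.
Proof.
move=> PY cov CC Ca al be al0; apply: initial_ideal_full => //.
have [pa pa' pc pc'] := pt_cover al 0%N be 0%N cov.
have [->|be0] := posnP be.
  apply: (vertex_notin_supp Ca al0) => m; rewrite mxE /pt.
  by case: eqVneq => _; rewrite ?muln1 ?muln0 ?if_same.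
have : [&& a != c, a != c', a' != c & a' != c'] && (a != a') && (c != c').
  by move: cov; rewrite /cover /= !inE !negb_or; do 6?case: (_ == _).
move=> /andP[/andP[/and4P[ac ac' a'c a'c'] aa'] cc'].
have [ca ca' c'a c'a'] : [/\ c != a, c != a', c' != a & c' != a'].
  by rewrite ![c == _]eq_sym ![c' == _]eq_sym.
move=> /CC[] h.
  have := cone2_coords h ca ca' c'a c'a'; rewrite !mxE pc pc' => /eqP.
  by rewrite eqr_nat eqn0Ngt be0.
have := cone2_coords h ac ac' a'c a'c'; rewrite !mxE pa pa' => /eqP.
rewrite eqr_nat.
by rewrite eqn0Ngt al0.
Qed.

End Assembly.

Theorem proposition5p17 (R : realType) (K : closedFieldType) (i j k l : 'I_4)
    (C : tropical_curve R) :
  [set i; j; k; l]%SET = [set: 'I_4]%SET ->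
  curve_supp C `<=` cone2 (cls_e R i) (cls_e R j) `|` cone2 (cls_e R k) (cls_e R l) ->
  mult C (cls_e int i) = 0%N ->
  mult C (cls_e int j) = 0%N ->
  mult C (cls_e int k) = 0%N ->
  realizable_in_L K C ->
  mult C (cls_e int l) <> 1%N.
Proof.
move=> ijkl CC Ci Cj Ck [Y YC] Cl.
have cov : cover i j k l.
  apply/card_uniqP; rewrite -[RHS](card_ord 4) -cardsT -ijkl -cardsE.
  by apply: eq_card => m; rewrite !inE !orbA.
have covC := coverC cov; have cov1 := cover_swap covC; have cov2 := cover_swap cov.
have cov3 : cover i j l k := coverC (cover_swap (coverC cov)).
have cov4 := cover_swap cov3; have cov5 : cover k l j i := coverC cov2.
(* The same inclusion with cones and generators permuted, one version for each of the six charts. *)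
have CC1 := CC; rewrite setUC in CC1.
have CC2 := CC; rewrite [cone2 (cls_e R i) _]cone2C in CC2.
have CC3 := CC; rewrite [cone2 (cls_e R k) _]cone2C in CC3.
have CC4 := CC3; rewrite [cone2 (cls_e R i) _]cone2C in CC4.
have CC5 := CC1; rewrite [cone2 (cls_e R i) _]cone2C in CC5.
have kl : k != l.
  by move: cov; rewrite /cover /= !inE !negb_or => /and4P[_ _ ? _].
have primL := primitive_vertex kl.
have trop2 P : P \in finsupp (cycle_coef Y) ->
    trop_mult P (lift_real R (cls_e int l)) != 0%E ->
    (2%:R%:E <= trop_mult P (lift_real R (cls_e int l)))%E.
  move=> PY; rewrite (@trop_mult_eq_weight R K _ (weights R (pt l k i 1 0 0 0)%N)) => [|nu d0].
    have [LP [chain _]] : curve_in_E P by case: Y PY {YC} => cY hY /= /hY.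
    apply: (trop_mult_vertex cov1 LP chain).
    - exact: (full_chart YC PY cov CC Ci).
    - exact: (full_chart YC PY cov3 CC3 Ci).
    - exact: (full_chart YC PY cov2 CC2 Cj).
    - exact: (full_chart YC PY cov4 CC4 Cj).
    - exact: (full_chart YC PY covC CC1 Ck).
    - exact: (full_chart YC PY cov5 CC5 Ck).
  by rewrite weight_lift // weight_vertex.
have := proj2 YC _ primL; rewrite Cl /Trop_mult.
have term0 P : (0 <= (cycle_coef Y P)%:R%:E *
    trop_mult P (lift_real R (cls_e int l)))%E.
  by rewrite mule_ge0 ?trop_mult_ge0 // lee_fin ler0n.
case: (pselect (exists2 P, P \in finsupp (cycle_coef Y) &
    trop_mult P (lift_real R (cls_e int l)) != 0%E)) => [[P PY mP]|none]; last first.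
  rewrite big_seq big1 => [/eqP|P PY]; first by rewrite eqe eq_sym oner_eq0.
  rewrite [trop_mult _ _](_ : _ = 0%E) ?mule0 //.
  by apply: contrapT => /eqP mP; apply: none; exists P.
(* A component with nonzero multiplicity occurs with coefficient at least 1 and so contributes at
   least 2; the other terms are nonnegative. *)
move=> sum1; have : (2%:R%:E <= (1%:R%:E : \bar R))%E.
  rewrite -sum1 (big_fsetD1 P) //=; apply: le_trans (leeDl _ _); last first.
    by apply: sume_ge0 => Q _; exact: term0.
  apply: (le_trans (trop2 P PY mP)); apply: lee_pemull; first exact: trop_mult_ge0.
  by rewrite lee_fin ler1n lt0n -mem_finsupp.
by rewrite lee_fin ler_nat.
Qed.
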